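(* Let $\mu\in\mathbb{R}$ and $t>0$, let $\{W_s^{(\mu,1)}\}_{s\ge0}$ be a Brownian motion with drift $\mu$ and unit variance parameter, and let $M_t^{(\mu,1)}=\max_{0\le s\le t}W_s^{(\mu,1)}$. Let $F_{M_t}(\cdot;\mu)$ be the distribution function of $M_t^{(\mu,1)}$ and $\zeta(v)=F_{M_t}^{-1}(v;\mu)$ for $v\in(0,1)$. Then the copula $C_{W_t,M_t}(\cdot,\cdot;\mu)$ of the pair $(W_t^{(\mu,1)},M_t^{(\mu,1)})$ is given, for $(u,v)\in(0,1)^2$, by $$C_{W_t,M_t}(u,v;\mu)=\begin{cases} u-e^{2\mu\zeta(v)}\,\Phi\left(\Phi^{-1}(u)-\frac{2\zeta(v)}{\sqrt t}\right) & \text{if } u\le\Phi\left(\frac{\zeta(v)-\mu t}{\sqrt t}\right),\\ v & \text{if } u>\Phi\left(\frac{\zeta(v)-\mu t}{\sqrt t}\right),\end{cases}$$ and the corresponding density function is $$c_{W_t,M_t}(u,v;\mu)=\frac{2e^{2\mu\zeta(v)}\,\phi\left(\Phi^{-1}(u)-\frac{2\zeta(v)}{\sqrt t}\right)}{f_{M_t}(\zeta(v);\mu)\,\phi\left(\Phi^{-1}(u)\right)}\left[\frac{1}{\sqrt t}\left(\frac{2\zeta(v)}{\sqrt t}-\Phi^{-1}(u)\right)-\mu\right]$$ if $u\le\Phi\left(\frac{\zeta(v)-\mu t}{\sqrt t}\right)$, and zero otherwise, where, for $y>0$, $$f_{M_t}(y;\mu)=\frac{1}{\sqrt t}\,\phi\left(\frac{y-\mu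 t}{\sqrt t}\right)-e^{2\mu y}\left[2\mu\,\Phi\left(\frac{-y-\mu t}{\sqrt t}\right)-\frac{1}{\sqrt t}\,\phi\left(\frac{-y-\mu t}{\sqrt t}\right)\right]$$ is the density function of $M_t^{(\mu,1)}$.
   Context: $\Phi$ and $\phi$ denote the standard normal distribution function and density. A Brownian motion with drift $\mu$ and unit variance parameter is the process $W_s^{(\mu,1)}=W_s+\mu s$, where $\{W_s\}$ is a standard Brownian motion started at $0$. For a distribution function $F$, $F^{-1}(u)=\inf\{x: F(x)\ge u\}$ for $u\in(0,1)$. For random variables $X_1,X_2$ with continuous distribution functions $F_1,F_2$ and joint distribution function $F$, the copula of $(X_1,X_2)$ is the unique function $C:[0,1]^2\to[0,1]$ that is a distribution function with uniform margins and satisfies $F(x_1,x_2)=C(F_1(x_1),F_2(x_2))$ for all $x_1,x_2$; equivalently $C(u_1,u_2)=F(F_1^{-1}(u_1),F_2^{-1}(u_2))$ for $(u_1,u_2)\in(0,1)^2$. The density function associated with $C$ is the function $c=\frac{\partial^2}{\partial u\,\partial v}C$, understood as the probability density of the distribution $C$ with respect to Lebesgue measure on $(0,1)^2$ (so values on a Lebesgue-null set are immaterial). *)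

(* Defs.v *)
From HB Require Import structures.
From mathcomp Require Import all_boot all_order all_algebra.
From mathcomp Require Import all_classical all_reals all_analysis.
From mathcomp Require Import measurable_realfun.

Set Implicit Arguments.
Unset Strict Implicit.
Unset Printing Implicit Defensive.

Import Order.TTheory GRing.Theory Num.Theory.
Import numFieldNormedType.Exports.

Local Open Scope classical_set_scope.
Local Open Scope ring_scope.

Section normal_law.
Context {R : realType}.

Definition Phi (x : R) : R := fine (normal_prob 0 1 `]-oo, x]).

Definition phi (x : R) : R := normal_pdf 0 1 x.

End normal_law.

(* The generalized inverse F^{-1}(u) = inf {x : F(x) >= u}. It is meant for
   0 < u < 1: elsewhere the set may be empty or unbounded below and `inf`
   returns a default value. *)
Definition quantile {R : realType} (F : R -> R) (u : R) : R :=
  inf [set x | u <= F x].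

Section distribution_functions.
Context {R : realType} {d : measure_display} {T : measurableType d}.
Variable P : probability T R.

(* The library's `cdf` has values in \bar R. *)
Definition dist_fun (X : {RV P >-> R}) (x : R) : R := fine (cdf X x).

Definition joint_dist_fun (X Y : {RV P >-> R}) (x y : R) : R :=
  fine (P (X @^-1` `]-oo, x] `&` Y @^-1` `]-oo, y])).

End distribution_functions.

Section brownian_motion.
Context {R : realType} {d : measure_display} {T : measurableType d}.
Variable P : probability T R.

(* As each A i may be the whole line, the product rule for the full family
   contains the one for every subfamily. *)
Definition mutually_independent n (X : 'I_n -> T -> R) : Prop :=
  forall A : 'I_n -> set R, (forall i, measurable (A i)) ->
    P (\bigcap_(i in [set: 'I_n]) X i @^-1` A i) =
    (\prod_(i < n) P (X i @^-1` A i))%E.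

Definition increment (W : R -> {RV P >-> R}) (s t : R) : T -> R :=
  fun w => W t w - W s w.

(* Only the variables W s with 0 <= s are constrained. The second argument of
   `normal_prob` is a standard deviation. *)
Definition standard_brownian_motion (W : R -> {RV P >-> R}) : Prop :=
  [/\ {ae P, forall w, W 0 w = 0},
      forall (t : nat -> R) (n : nat),
        0 <= t 0%N -> (forall i, t i <= t i.+1) ->
        mutually_independent (fun i : 'I_n => increment W (t i) (t i.+1)),
      forall s t : R, 0 <= s -> s < t ->
        forall A : set R, measurable A ->
          P (increment W s t @^-1` A) =
          normal_prob 0 (Num.sqrt (t - s)) A
    & {ae P, forall w, {within `[0, +oo[, continuous (fun s => W s w)}}].

Definition drifted (W : R -> {RV P >-> R}) (mu s : R) : T -> R :=
  fun w => W s w + mu * s.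

Lemma measurable_drifted (W : R -> {RV P >-> R}) (mu s : R) :
  measurable_fun setT (drifted W mu s).
Proof. exact: measurable_funD. Qed.

HB.instance Definition _ (W : R -> {RV P >-> R}) (mu s : R) :=
  isMeasurableFun.Build _ _ _ _ (drifted W mu s) (measurable_drifted W mu s).

(* The paths being continuous almost surely only, the maximum is determined up
   to a null set: M is any version of it. *)
Definition running_max (X : R -> T -> R) (t : R) (M : {RV P >-> R}) :
    Prop :=
  {ae P, forall w,
    (exists2 s, 0 <= s <= t & M w = X s w) /\
    (forall s, 0 <= s <= t -> X s w <= M w)}.

End brownian_motion.

(* The measure Q has density f with respect to m, and is carried by D; the
   values of f outside D are irrelevant. *)
Definition density_on {R : realType} {d : measure_display}
    {T : measurableType d} (m : {measure set T -> \bar R})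
    (Q : set T -> \bar R) (D : set T) (f : T -> R) : Prop :=
  [/\ measurable D, measurable_fun D f, (forall x, D x -> 0 <= f x)
    & forall A, measurable A -> Q A = (\int[m]_(x in D `&` A) (f x)%:E)%E].

(* A copula is a map [0,1]^2 -> [0,1], encoded as a function R -> R -> R of
   which only the values on [0,1]^2 matter. *)
Section copulas.
Context {R : realType}.
Implicit Types (C : R -> R -> R).

Definition uniform_margins (Q : probability (R * R)%type R) : Prop :=
  forall A : set R, measurable A ->
    Q (A `*` setT) = uniform_prob (@ltr01 R) A /\
    Q (setT `*` A) = uniform_prob (@ltr01 R) A.

Definition copula_law C (Q : probability (R * R)%type R) : Prop :=
  uniform_margins Q /\
  forall u v : R, 0 <= u <= 1 -> 0 <= v <= 1 ->
    (C u v)%:E = Q (`]-oo, u] `*` `]-oo, v]).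

Definition is_copula C : Prop := exists Q, copula_law C Q.

Definition copula_of {d : measure_display} {T : measurableType d}
    (P : probability T R) (X Y : {RV P >-> R}) C : Prop :=
  [/\ continuous (dist_fun X), continuous (dist_fun Y), is_copula C
    & forall x y : R,
        joint_dist_fun X Y x y = C (dist_fun X x) (dist_fun Y y)].

(* The law Q is determined by C, since C gives its joint distribution
   function and Q is carried by [0,1]^2. *)
Definition copula_density C (c : R -> R -> R) : Prop :=
  exists2 Q : probability (R * R)%type R, copula_law C Q &
    density_on (lebesgue_measure \x lebesgue_measure)%E Q
      (`]0, 1[ `*` `]0, 1[) (fun z : R * R => c z.1 z.2).

End copulas.

Section formulas.
Context {R : realType}.
Variables (mu t : R).

Definition max_density (y : R) : R :=
  (Num.sqrt t)^-1 * phi ((y - mu * t) / Num.sqrt t) -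
  expR (2 * mu * y) *
    (2 * mu * Phi ((- y - mu * t) / Num.sqrt t) -
     (Num.sqrt t)^-1 * phi ((- y - mu * t) / Num.sqrt t)).

(* The argument zeta is the quantile function of the running maximum. *)
Variable zeta : R -> R.

Definition BM_max_copula (u v : R) : R :=
  if u <= Phi ((zeta v - mu * t) / Num.sqrt t) then
    u - expR (2 * mu * zeta v) *
        Phi (quantile Phi u - 2 * zeta v / Num.sqrt t)
  else v.

Definition BM_max_copula_density (u v : R) : R :=
  if u <= Phi ((zeta v - mu * t) / Num.sqrt t) then
    2 * expR (2 * mu * zeta v) *
      phi (quantile Phi u - 2 * zeta v / Num.sqrt t) /
    (max_density (zeta v) * phi (quantile Phi u)) *
    ((Num.sqrt t)^-1 * (2 * zeta v / Num.sqrt t - quantile Phi u) - mu)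
  else 0.

End formulas.

(* Main.v *)
Require Import Defs.
From HB Require Import structures.
From mathcomp Require Import all_boot all_order all_algebra.
From mathcomp Require Import all_classical all_reals all_analysis.
From mathcomp Require Import measurable_realfun ring lra.

Set Implicit Arguments.
Unset Strict Implicit.
Unset Printing Implicit Defensive.

Import Order.TTheory GRing.Theory Num.Theory.
Import numFieldNormedType.Exports.

Local Open Scope classical_set_scope.
Local Open Scope ring_scope.

(** For a level y >= 0 and a <= y, the reflection principle for the drifted
    process reads P(X_t <= a, M_t > y) = E[r_y(X_t)] with the weight
    r_y(x) = e^{2 mu (y - x)} 1{x >= 2 y - a}. It is obtained without the strong
    Markov property. From a starting point x at or above y, the probability of
    ending below a is at most the expectation of r_y, and from a point at or
    below y it is at least that expectation: completing the square turns the
    weight into e^{2 (y - x)(w - (y - x)) / s} on the increments w <= a - x.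
    Splitting according to the first point of a time grid at which the process
    lies in an open set O, and applying the comparison to the independent
    increment after that time, gives one inequality for O = ]y, +oo[ and the
    reverse one, with y' > y in place of y, for O = ]y, y'[, which a continuous
    path going above y' must meet. Refining the grid and then letting y' tend to
    y yields the joint distribution function of (X_t, M_t).

    The copula is the law of (F(X_t), G(M_t)), F and G being the marginal
    distribution functions. Relative to the product of the laws of X_t and M_t
    the joint law has density c(F(x), G(y)): this is checked on quadrants, since
    c(F(x), G(y)) f_M(y) is the y-derivative of - e^{2 y (x - y) / t} for
    y > max(x, 0). As F(X_t) and G(M_t) are uniform, c is the density of the
    copula. *)

(** * Change of variables and uniqueness of measures *)

(** The first visit on a grid happens beyond the level y rather than at it, so the exact symmetry
    about y is lost; what survives is an inequality whose direction depends on the side of y. Hence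
    O lies above y in one bound, whereas in the other it is a band below y', whose points cannot
    overshoot y'. The weight is a ratio of Gaussian densities: for a normal increment started at y,
    e^{2 mu (y - x)} is the density at 2 y - x divided by the density at x. This ratio does not
    involve the elapsed time, so one function of X_t serves for every hitting time, and its
    expectation under the law of X_t is already the closed formula. Since the hitting index takes
    finitely many values, it is enough that the increment after a fixed grid time is independent of
    the earlier grid increments. *)

Section density_measure.
Local Open Scope ereal_scope.
Context d (T : measurableType d) (R : realType).
Variables (m : {measure set T -> \bar R}) (f : T -> R).

(** The two proofs are arguments so that the measure structure declared below can be inferred from
    the term [density_measure mf f0] alone. *)
Definition density_measure (mf : measurable_fun setT f) (f0 : forall x, (0 <= f x)%R)
  : set T -> \bar R := fun A => \int[m]_(x in A) (f x)%:E.

Hypotheses (mf : measurable_fun setT f) (f0 : forall x, (0 <= f x)%R).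
Local Notation nu := (density_measure mf f0).

Let nu0 : nu set0 = 0. Proof. exact: integral_set0. Qed.

Let nu_ge0 A : 0 <= nu A.
Proof. by apply: integral_ge0 => x _; rewrite lee_fin. Qed.

Let nu_sigma_additive : semi_sigma_additive nu.
Proof.
move=> F mF tF mUF; rewrite /density_measure; apply: cvg_toP.
  apply: ereal_nondecreasing_is_cvgn => p q pq.
  by apply: lee_sum_nneg_natr => // k _ _; exact: nu_ge0.
rewrite ge0_integral_bigcup//; last by move=> x _; rewrite lee_fin.
by apply/measurable_EFinP; exact: measurable_funTS.
Qed.

HB.instance Definition _ := isMeasure.Build _ _ _ nu
  nu0 nu_ge0 nu_sigma_additive.

Import HBNNSimple.

Let mEf : measurable_fun setT (EFin \o f). Proof. exact/measurable_EFinP. Qed.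

Let Ef0 x : 0 <= (f x)%:E. Proof. by rewrite lee_fin. Qed.

Variable Q : {measure set T -> \bar R}.
Hypothesis QE : forall A, measurable A -> Q A = \int[m]_(x in A) (f x)%:E.

Let integral_density_nnsfun (g : {nnsfun T >-> R}) :
  \int[Q]_x (g x)%:E = \int[m]_x ((g x)%:E * (f x)%:E).
Proof.
under [LHS]eq_integral do rewrite fimfunE -fsumEFin//.
rewrite [LHS]ge0_integral_fsum//; last 2 first.
  - by move=> r; exact/measurable_EFinP/measurableT_comp.
  - by move=> n x _; rewrite EFinM nnfun_muleindic_ge0.
under [RHS]eq_integral.
  move=> x xD; rewrite fimfunE -fsumEFin// ge0_mule_fsuml; last first.
    by move=> r; rewrite EFinM nnfun_muleindic_ge0.
  over.
rewrite [RHS]ge0_integral_fsum//; last 2 first.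
  - move=> r; apply: emeasurable_funM => //.
    by apply/measurable_EFinP; exact/measurableT_comp.
  - by move=> n x _; rewrite mule_ge0// EFinM nnfun_muleindic_ge0.
apply: eq_fsbigr => r _.
have [r0|r0] := leP 0%R r; last first.
  rewrite preimage_nnfun0//= !integral0_eq// => x _;
  by rewrite indic0 mulr0// mul0e.
under eq_integral do rewrite EFinM.
rewrite ge0_integralZl//; last exact/measurable_EFinP/measurable_indic.
under [RHS]eq_integral do rewrite EFinM -muleA.
rewrite [RHS]ge0_integralZl//; last 2 first.
- by apply: emeasurable_funM => //; exact/measurable_EFinP/measurable_indic.
- by move=> t _; rewrite mule_ge0// lee_fin.
congr (_ * _); rewrite integral_indic// setIT QE//.
rewrite integral_mkcond; apply: eq_integral => x _.
by rewrite patchE indicE; case: ifPn => _; rewrite ?mul1e ?mul0e.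
Qed.

(** Simple functions, then monotone convergence. [Q] is any measure known to have density [f], so
    the lemma serves the normal laws, the law of the maximum and the uniform law of [F (X w)]
    alike. *)
Lemma ge0_integral_density (g : T -> \bar R) :
    measurable_fun setT g -> (forall x, 0 <= g x) ->
  \int[Q]_x g x = \int[m]_x (g x * (f x)%:E).
Proof.
move=> mg g0.
pose g_ := nnsfun_approx measurableT mg.
transitivity (lim (\int[Q]_x (g_ n x)%:E @[n --> \oo])).
  rewrite -monotone_convergence//=.
  - apply: eq_integral => ? /[!inE] xD; apply/esym/cvg_lim => //=.
    exact: cvg_nnsfun_approx.
  - by move=> n; exact/measurable_EFinP/measurable_funTS.
  - by move=> n ? _; rewrite lee_fin.
  - by move=> ? _ ? ? mn; rewrite lee_fin; exact/lefP/nd_nnsfun_approx.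
under eq_fun do rewrite integral_density_nnsfun.
rewrite -monotone_convergence//=.
- apply: eq_integral => x _; apply/cvg_lim => //=.
  apply: cvgeZr => //.
  exact: cvg_nnsfun_approx.
- by move=> n; apply: emeasurable_funM => //; exact/measurable_EFinP/measurable_funTS.
- by move=> n ? _; rewrite mule_ge0// lee_fin.
- by move=> x _ p q pq; rewrite lee_wpmul2r// lee_fin; exact/lefP/nd_nnsfun_approx.
Qed.

End density_measure.

Section image_measure.
Local Open Scope ereal_scope.
Context d d' (T1 : measurableType d) (T2 : measurableType d') (R : realType).
Variables (m : {measure set T1 -> \bar R}) (f : T1 -> T2).
Hypothesis mf : measurable_fun [set: T1] f.

Definition image_measure : {measure set T2 -> \bar R} :=
  measure_function_pushforward__canonical__measure_function_Measure m mf.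

Lemma image_measureE A : image_measure A = m (f @^-1` A).
Proof. by []. Qed.

Lemma ge0_integral_image (g : T2 -> \bar R) :
  measurable_fun setT g -> (forall y, 0 <= g y) ->
  \int[image_measure]_y g y = \int[m]_x g (f x).
Proof. by move=> mg g0; rewrite ge0_integral_pushforward. Qed.

End image_measure.

Section cdf_uniqueness.
Local Open Scope ereal_scope.
Context {R : realType}.

Lemma measurable_itvNyc : @measurable _ R =
  <<s [set A : set R | exists x, A = `]-oo, x]%classic] >>.
Proof.
rewrite eqEsubset; split => A.
  apply: smallest_sub; first exact: smallest_sigma_algebra.
  move=> _ [[a b] _ <-] /=.
  have -> : `]a, b]%classic = `]-oo, b] `\` `]-oo, a] :> set R.
    by rewrite setDE setCitvl predeqE => x; rewrite /= !in_itv/= andbT; split=> [/andP[]|[-> ->]].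
  have [_ sC sU] := smallest_sigma_algebra setT
    [set A : set R | exists x, A = `]-oo, x]%classic].
  (* The closure properties at hand are complement and countable union, so the difference is
     rewritten as the complement of a union of two sets. *)
  rewrite setDE -[X in _ X]setCK setCI setCK -bigcup2E.
  apply: sigma_algebraC; apply: sU => -[|[|n]]; rewrite /bigcup2/=.
  - by apply: sigma_algebraC; apply: sub_sigma_algebra; exists b.
  - by apply: sub_sigma_algebra; exists a.
  - exact: sigma_algebra0.
apply: smallest_sub; first exact: sigma_algebra_measurable.
by move=> _ [x ->]; exact: measurable_itv.
Qed.

Lemma finite_measure_cdf_unique (m1 m2 : {measure set R -> \bar R}) :
  (forall x : R, m1 `]-oo, x]%classic < +oo) ->
  (forall x : R, m1 `]-oo, x]%classic = m2 `]-oo, x]%classic) ->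
  forall A, measurable A -> m1 A = m2 A.
Proof.
move=> m1oo m12 A mA.
apply: (measure_unique [set A : set R | exists x, A = `]-oo, x]%classic]
  (fun n => `]-oo, n%:R]%classic)) => //.
- exact: measurable_itvNyc.
- move=> _ _ [x ->] [y ->]; exists (Num.min x y).
  by rewrite predeqE => z; rewrite /= !in_itv/= le_min; split=> [[-> ->]|/andP[]].
- by move=> i; eexists.
- rewrite -subTset => x _; exists (Num.truncn `|x|).+1 => //=.
  rewrite in_itv/= (le_trans (ler_norm _))// ltW//.
  exact: truncnS_gt.
- by move=> _ [x ->].
Qed.

(** Half-lines are replaced by arbitrary measurable sets one coordinate at a time: with the other
    factor fixed, the mass of a rectangle is a projection of a restricted measure, to which the
    one-dimensional uniqueness applies. *)
Lemma finite_measure_joint_cdf_unique (m1 m2 : {measure set (R * R) -> \bar R}) :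
  m1 setT < +oo ->
  (forall x y : R, m1 (`]-oo, x]%classic `*` `]-oo, y]%classic) = m2 (`]-oo, x]%classic `*` `]-oo, y]%classic)) ->
  forall A, measurable A -> m1 A = m2 A.
Proof.
move=> m1oo m12.
have m1lty A : measurable A -> m1 A < +oo.
  by move=> mA; apply: le_lt_trans m1oo; apply: le_measure; rewrite ?inE.
have step1 (y : R) A : measurable A -> m1 (A `*` `]-oo, y]%classic) = m2 (A `*` `]-oo, y]%classic).
  have mS : measurable (snd @^-1` `]-oo, y]%classic : set (R * R)).
    by rewrite -[X in measurable X]setTI; exact: measurable_snd.
  have E (m : {measure set (R * R) -> \bar R}) (B : set R) :
      m (B `*` `]-oo, y]%classic) = image_measure (mrestr m mS) measurable_fst B by [].
  move=> mA; rewrite !E.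
  apply: (@finite_measure_cdf_unique (image_measure (mrestr m1 mS) measurable_fst) (image_measure (mrestr m2 mS) measurable_fst)) => // x.
    by rewrite -E m1lty//; exact: measurableX.
  by rewrite -!E.
have step2 (A B : set R) : measurable A -> measurable B -> m1 (A `*` B) = m2 (A `*` B).
  move=> mA.
  have mS : measurable (fst @^-1` A : set (R * R)).
    by rewrite -[X in measurable X]setTI; exact: measurable_fst.
  have E (m : {measure set (R * R) -> \bar R}) (B' : set R) :
      m (A `*` B') = image_measure (mrestr m mS) measurable_snd B'.
    by rewrite image_measureE /= /mrestr setIC.
  move=> mB; rewrite !E.
  apply: (@finite_measure_cdf_unique (image_measure (mrestr m1 mS) measurable_snd) (image_measure (mrestr m2 mS) measurable_snd)) => // x.
    by rewrite -E m1lty//; exact: measurableX.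
  by rewrite -!E; exact: step1.
move=> A mA.
pose C : set (set (R * R)) :=
  [set C | exists2 A, measurable A & exists2 B, measurable B & A `*` B = C].
apply: (measure_unique C (fun=> setT)) => //.
- by rewrite measurable_prod_measurableType.
- move=> /= _ _ [X1 mX1 [X2 mX2 <-]] [Y1 mY1 [Y2 mY2 <-]].
  rewrite -setXI; exists (X1 `&` Y1); first exact: measurableI.
  by exists (X2 `&` Y2) => //; exact: measurableI.
- by move=> _; exists setT => //; exists setT => //; rewrite setXTT.
- by rewrite bigcup_const.
- by move=> _ [X1 mX1 [X2 mX2 <-]]; exact: step2.
Qed.

End cdf_uniqueness.

Section lebesgue_affine.
Local Open Scope ereal_scope.
Context {R : realType}.
Notation mu := (@lebesgue_measure R).

Lemma lebesgue_measure_affine (a b : R) (A : set R) : (0 < a)%R ->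
  measurable A -> mu A = a%:E * mu ((fun x => a * x + b)%R @^-1` A).
Proof.
move=> a0 mA.
(* Lebesgue measure lives on [measurableTypeR R], so the map is typed on that copy of the line
   before it is used for a pushforward. *)
pose h (x : measurableTypeR R) : measurableTypeR R := (a * x + b)%R.
have mh : measurable_fun setT h.
  by apply: (@measurable_funD _ R) => //; exact: (@measurable_funM _ R).
pose na : {nonneg R} := NngNum (ltW a0).
apply: (@lebesgue_measure_unique _ (mscale na (image_measure mu mh))) => //.
move=> _ [[p q] _ <-]; change (mu `]p, q] = a%:E * mu (h @^-1` `]p, q])).
have -> : h @^-1` `]p, q] = `]((p - b) / a)%R, ((q - b) / a)%R]%classic.
  rewrite predeqE => x; rewrite /h /= !in_itv/=.
  by rewrite ltr_pdivrMr// ler_pdivlMr// ltrBlDr lerBrDr mulrC.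
rewrite !lebesgue_measure_itv/= !lte_fin.
rewrite ltr_pM2r ?invr_gt0// ltrD2r.
case: ifPn => _; last by rewrite mule0.
rewrite -!EFinB -EFinM; congr EFin.
by field; rewrite gt_eqF.
Qed.

Lemma ge0_integral_affine (a b : R) (f : R -> \bar R) : (0 < a)%R ->
  measurable_fun setT f -> (forall x, 0 <= f x) ->
  \int[mu]_x f x = a%:E * \int[mu]_x f (a * x + b)%R.
Proof.
move=> a0 mf f0.
pose h (x : measurableTypeR R) : measurableTypeR R := (a * x + b)%R.
have mh : measurable_fun setT h.
  by apply: (@measurable_funD _ R) => //; exact: (@measurable_funM _ R).
pose na : {nonneg R} := NngNum (ltW a0).
rewrite (@eq_measure_integral _ (measurableTypeR R) R setT
  (mscale na (image_measure mu mh)) mu f); last first.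
  by move=> A mA _; exact: lebesgue_measure_affine.
rewrite ge0_integral_mscale//; congr (_ * _).
exact: (@ge0_integral_image _ _ (measurableTypeR R) (measurableTypeR R) R mu h).
Qed.

Lemma ge0_integral_opp (f : R -> \bar R) :
  measurable_fun setT f -> (forall x, 0 <= f x) ->
  \int[mu]_x f x = \int[mu]_x f (- x)%R.
Proof.
move=> mf f0.
pose h (x : measurableTypeR R) : measurableTypeR R := (- x)%R.
have mh : measurable_fun setT h by exact: (@measurable_funN _ R).
rewrite (@eq_measure_integral _ (measurableTypeR R) R setT
  (image_measure mu mh) mu f); last first.
  by move=> A mA _; apply/esym; exact: lebesgue_measureN.
exact: (@ge0_integral_image _ _ (measurableTypeR R) (measurableTypeR R) R mu h).
Qed.

End lebesgue_affine.

(** * Gaussian integrals and the reflected weight *)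

Section gaussian.
Context {R : realType}.
Local Notation leb := (@lebesgue_measure R).

Lemma normal_pdf_exp (m s x : R) : s != 0 ->
  normal_pdf m s x = normal_peak s * expR (- (x - m) ^+ 2 / (s ^+ 2 *+ 2)).
Proof. by move=> s0; rewrite normal_pdfE. Qed.

Lemma normal_peakM (s : R) : 0 < s -> normal_peak 1 = s * normal_peak s.
Proof.
have E (c : R) : Num.sqrt (c ^+ 2 * pi *+ 2) = `|c| * Num.sqrt (pi *+ 2).
  by rewrite -mulrnAr sqrtrM ?sqr_ge0// sqrtr_sqr.
move=> s0; rewrite /normal_peak !E normr1 mul1r gtr0_norm//.
by rewrite invfM mulVKf// gt_eqF.
Qed.

Lemma normal_pdf_std (m s x : R) : 0 < s ->
  normal_pdf m s x = s^-1 * phi ((x - m) / s).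
Proof.
move=> s0; rewrite /phi !normal_pdf_exp ?gt_eqF//.
rewrite (normal_peakM s0) -mulrA mulKf ?gt_eqF//; congr (_ * expR _).
by rewrite subr0 expr1n; field; rewrite gt_eqF.
Qed.

Lemma ge0_integral_normal (m s : R) (f : R -> \bar R) :
  measurable_fun setT f -> (forall x, 0 <= f x)%E ->
  (\int[normal_prob m s]_x f x = \int[leb]_x (f x * (normal_pdf m s x)%:E))%E.
Proof.
move=> mf f0; apply: ge0_integral_density => //.
  exact: measurable_normal_pdf.
by move=> x; exact: normal_pdf_ge0.
Qed.

Lemma ge0_integral_normal_affine (m s : R) (f : R -> \bar R) : 0 < s ->
  measurable_fun setT f -> (forall x, 0 <= f x)%E ->
  (\int[normal_prob m s]_x f x = \int[normal_prob 0 1]_x f (s * x + m)%R)%E.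
Proof.
move=> s0 mf f0.
have mh : measurable_fun setT (fun x : R => s * x + m).
  by apply: measurable_funD => //; exact: measurable_funM.
have mfh : measurable_fun setT (fun x : R => f (s * x + m)).
  exact: measurableT_comp mf mh.
have mpdf : measurable_fun setT (fun x : R => (normal_pdf m s x)%:E).
  by apply/measurable_EFinP; exact: measurable_normal_pdf.
rewrite (ge0_integral_normal m s mf f0) (ge0_integral_normal 0 1 mfh (fun x => f0 _)).
have fpdf0 x : (0 <= f x * (normal_pdf m s x)%:E)%E.
  by rewrite mule_ge0// lee_fin normal_pdf_ge0.
rewrite (ge0_integral_affine m s0 (emeasurable_funM mf mpdf) fpdf0).
rewrite -(ge0_integralZl _ measurableT _ (fun x _ => fpdf0 _)); last 2 first.
- by apply: emeasurable_funM => //; exact: measurableT_comp mpdf mh.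
- by rewrite lee_fin ltW.
apply: eq_integral => x _; rewrite muleCA; congr (_ * _)%E.
rewrite -EFinM; congr EFin.
by rewrite normal_pdf_std// addrK [s * x]mulrC mulfK ?gt_eqF// mulVKf// gt_eqF.
Qed.

Lemma normal_prob_affine (m s : R) (A : set R) : 0 < s -> measurable A ->
  normal_prob m s A = normal_prob 0 1 ((fun x => s * x + m) @^-1` A).
Proof.
move=> s0 mA.
have mh : measurable_fun setT (fun x : R => s * x + m).
  by apply: measurable_funD => //; exact: measurable_funM.
have mB : measurable ((fun x => s * x + m) @^-1` A).
  by rewrite -[X in measurable X]setTI; exact: mh.
have E m' s' (B : set R) : measurable B ->
    normal_prob m' s' B = (\int[normal_prob m' s']_x (\1_B x)%:E)%E.
  by move=> mB'; rewrite integral_indic// setIT.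
rewrite (E _ _ _ mA) (E _ _ _ mB) ge0_integral_normal_affine.
- by [].
- exact: s0.
- exact/measurable_EFinP/measurable_indic.
- by move=> x; rewrite lee_fin.
Qed.

(* [normal_prob] lives on [measurableTypeR R], whose display differs from that
   of [R]; this is the same measure on [R] itself. *)
Let idR : measurableTypeR R -> R := idfun.

Let measurable_idR : measurable_fun setT idR.
Proof. by move=> _ A mA; rewrite setTI; exact: mA. Qed.

HB.instance Definition _ := isMeasurableFun.Build _ _ _ _ idR measurable_idR.

Definition normal_law (m s : R) : probability R R :=
  distribution (normal_prob m s) idR.

Lemma ge0_integral_normal_law m s (f : R -> \bar R) :
  measurable_fun setT f -> (forall x, 0 <= f x)%E ->
  (\int[normal_law m s]_x f x = \int[normal_prob m s]_x f x)%E.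
Proof. by move=> mf f0; rewrite ge0_integral_distribution. Qed.

Lemma PhiE (x : R) : (Phi x)%:E = normal_prob 0 1 `]-oo, x]%classic.
Proof. by rewrite /Phi fineK// fin_num_measure. Qed.

Lemma normal_prob_Nyc (m s x : R) : 0 < s ->
  normal_prob m s `]-oo, x]%classic = (Phi ((x - m) / s))%:E.
Proof.
move=> s0; rewrite normal_prob_affine// PhiE; congr (normal_prob 0 1 _).
rewrite predeqE => z; rewrite /= !in_itv/= ler_pdivlMr// lerBrDr mulrC.
by [].
Qed.

End gaussian.

Section gaussian_reflection.
Context {R : realType}.
Variables (mu s : R).
Hypothesis s0 : 0 < s.
Local Notation leb := (@lebesgue_measure R).
Local Notation m := (mu * s ^+ 2).

(* The weight [refl_weight c b] integrates to the mass that the reflection at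
   level [c] puts on paths ending below [b], corrected by the Girsanov factor. *)
Definition refl_weight (c b w : R) : R := expR (2 * mu * (c - w)) * \1_(`[2 * c - b, +oo[%classic : set R) w.

(** For [0 <= c] and [w <= c] the exponential is the probability that a Brownian bridge from 0 to
    [w], of duration [s ^+ 2], exceeds [c]. *)
Definition bridge_weight (c b w : R) : R := expR (2 * c * (w - c) / s ^+ 2) * \1_(`]-oo, b]%classic : set R) w.

Lemma refl_weight_ge0 (c b w : R) : 0 <= refl_weight c b w.
Proof. by rewrite mulr_ge0 ?expR_ge0. Qed.

Lemma bridge_weight_ge0 (c b w : R) : 0 <= bridge_weight c b w.
Proof. by rewrite mulr_ge0 ?expR_ge0. Qed.

Lemma measurable_refl_weight (c b : R) : measurable_fun setT (refl_weight c b).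
Proof.
apply: measurable_funM.
  apply: measurableT_comp => //; apply: measurable_funM => //; exact: measurable_funB.
exact: measurable_indic.
Qed.

Lemma measurable_bridge_weight (c b : R) : measurable_fun setT (bridge_weight c b).
Proof.
apply: measurable_funM.
  apply: measurableT_comp => //; apply: measurable_funM => //.
  by apply: measurable_funM => //; exact: measurable_funB.
exact: measurable_indic.
Qed.

(** Substituting 2 c - w for w multiplies the normal density by e^{2 mu (c - w)} e^{2 c (w - c) /
    s^2}; the first factor cancels the reflected Girsanov factor, and the drift disappears from the
    weight. *)
Lemma integral_refl_weight (c b : R) :
  (\int[normal_prob m s]_w (refl_weight c b w)%:E =
   \int[normal_prob m s]_w (bridge_weight c b w)%:E)%E.
Proof.
have mr := measurable_refl_weight c b.
have mr' : measurable_fun setT (fun w => (refl_weight c b w)%:E) by exact/measurable_EFinP.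
have mb := measurable_bridge_weight c b.
have mb' : measurable_fun setT (fun w => (bridge_weight c b w)%:E) by exact/measurable_EFinP.
have mpdf := measurable_normal_pdf m s.
rewrite (ge0_integral_normal m s mr'); last first.
  by move=> w; rewrite lee_fin refl_weight_ge0.
rewrite (ge0_integral_normal m s mb'); last first.
  by move=> w; rewrite lee_fin bridge_weight_ge0.
rewrite [LHS]ge0_integral_opp; last 2 first.
- by apply/measurable_EFinP; exact: measurable_funM.
- by move=> w; rewrite lee_fin mulr_ge0 ?refl_weight_ge0 ?normal_pdf_ge0.
rewrite (ge0_integral_affine (- (2 * c)) ltr01) ?mul1e; last 2 first.
- apply/measurable_EFinP; apply: (measurableT_comp (f := fun w => refl_weight c b w * normal_pdf m s w)) => //.
  exact: measurable_funM.
- by move=> w; rewrite lee_fin mulr_ge0 ?refl_weight_ge0 ?normal_pdf_ge0.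
apply: eq_integral => w _; rewrite -!EFinM; congr EFin.
rewrite /refl_weight /bridge_weight mul1r !indicE !mem_setE !in_itv/= andbT.
have -> : (2 * c - b <= - (w - 2 * c)) = (w <= b) by rewrite opprB lerD2l lerN2.
rewrite mulrAC [RHS]mulrAC; congr (_ * _).
rewrite !normal_pdf_exp ?gt_eqF// mulrCA [RHS]mulrCA; congr (_ * _).
rewrite -!expRD; congr expR.
by field; rewrite gt_eqF.
Qed.

(** An exponential tilt shifts a normal law: the weight turns the density with mean m into e^{2 mu
    c} times the density with mean m + 2 c, whence the translation by [2 * c]. *)
Lemma integral_bridge_weight (c b : R) :
  (\int[normal_prob m s]_w (bridge_weight c b w)%:E =
   (expR (2 * mu * c) * Phi ((b - 2 * c - m) / s))%:E)%E.
Proof.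
have mb := measurable_bridge_weight c b.
have mb' : measurable_fun setT (fun w => (bridge_weight c b w)%:E) by exact/measurable_EFinP.
have mpdf := measurable_normal_pdf m s.
rewrite (ge0_integral_normal m s mb'); last first.
  by move=> w; rewrite lee_fin bridge_weight_ge0.
rewrite (ge0_integral_affine (2 * c) ltr01) ?mul1e; last 2 first.
- by apply/measurable_EFinP; exact: measurable_funM.
- by move=> w; rewrite lee_fin mulr_ge0 ?bridge_weight_ge0 ?normal_pdf_ge0.
transitivity (\int[leb]_w ((expR (2 * mu * c))%:E * ((\1_`]-oo, b - 2 * c] w)%:E * (normal_pdf m s w)%:E)))%E.
  apply: eq_integral => w _; rewrite -!EFinM; congr EFin.
  rewrite /bridge_weight mul1r !indicE !mem_setE !in_itv/= lerBrDr mulrA.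
  rewrite mulrAC [RHS]mulrAC; congr (_ * _).
  rewrite !normal_pdf_exp ?gt_eqF// mulrCA [RHS]mulrCA; congr (_ * _).
  rewrite -!expRD; congr expR.
  by field; rewrite gt_eqF.
have mi : measurable_fun setT (fun w : R => (\1_(`]-oo, b - 2 * c]%classic : set R) w : R)%:E).
  by apply/measurable_EFinP; exact: measurable_indic.
rewrite ge0_integralZl; last 4 first.
- by [].
- by apply: emeasurable_funM => //; exact/measurable_EFinP.
- by move=> w _; rewrite lee_fin mulr_ge0// normal_pdf_ge0.
- by rewrite lee_fin expR_ge0.
rewrite -(ge0_integral_normal m s mi) ?EFinM; last by move=> w; rewrite lee_fin.
congr (_ * _)%E; rewrite integral_indic// setIT; exact: normal_prob_Nyc.
Qed.

(* For [b <= c] a path from [0] ending below [b] charges the bridge weight at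
   points [w < c], where the exponent has the sign of [- c]. *)
Lemma le_bridge_weight (c b w : R) : b <= c -> c <= 0 -> \1_(`]-oo, b]%classic : set R) w <= bridge_weight c b w.
Proof.
move=> bc c0; rewrite /bridge_weight !indicE !mem_setE !in_itv/=; have [wb|wb] := leP w b; last by rewrite mulr0n mulr0.
rewrite mulr1n mulr1 -expR0 ler_expR mulr_ge0 ?invr_ge0 ?sqr_ge0//.
rewrite mulr_le0 //; first by rewrite pmulr_rle0.
by rewrite subr_le0 (le_trans wb).
Qed.

Lemma bridge_weight_le (c b w : R) : b <= c -> 0 <= c -> bridge_weight c b w <= \1_(`]-oo, b]%classic : set R) w.
Proof.
move=> bc c0; rewrite /bridge_weight !indicE !mem_setE !in_itv/=; have [wb|wb] := leP w b; last by rewrite mulr0n mulr0.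
rewrite mulr1n mulr1 -expR0 ler_expR mulr_le0_ge0 ?invr_ge0 ?sqr_ge0//.
rewrite mulr_ge0_le0 //; first by rewrite pmulr_rge0.
by rewrite subr_le0 (le_trans wb).
Qed.

Lemma refl_weightD (c b x w : R) : refl_weight c b (x + w) = refl_weight (c - x) (b - x) w.
Proof.
rewrite /refl_weight !indicE !mem_setE !in_itv/= !andbT.
congr (expR _ * _); first by ring.
by congr (_%:R); congr nat_of_bool; apply/idP/idP => h; lra.
Qed.

Let indicD (a x w : R) : \1_(`]-oo, a]%classic : set R) (x + w) =
  \1_(`]-oo, a - x]%classic : set R) w :> R.
Proof. by rewrite !indicE !mem_setE !in_itv/= lerBrDl. Qed.

(** The indicator and the reflected weight charge opposite sides of the level and cannot be compared
    pointwise. After translation to the start 0, [integral_refl_weight] replaces the latter by a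
    bridge weight on the same half-line as the indicator, and there a pointwise comparison
    decides. *)
Lemma le_integral_refl (a y x : R) : a <= y -> y <= x ->
  (\int[normal_prob m s]_w (\1_(`]-oo, a]%classic : set R) (x + w))%:E <=
   \int[normal_prob m s]_w (refl_weight y a (x + w))%:E)%E.
Proof.
move=> ay yx.
under eq_integral do rewrite indicD.
under [leRHS]eq_integral do rewrite refl_weightD.
rewrite integral_refl_weight; apply: ge0_le_integral => //.
- by apply/measurable_EFinP; exact: measurable_indic.
- by apply/measurable_EFinP; exact: measurable_bridge_weight.
- by move=> w _; rewrite lee_fin le_bridge_weight// ?lerD2r// subr_le0.
Qed.

Lemma integral_refl_le (a y x : R) : a <= y -> x <= y ->
  (\int[normal_prob m s]_w (refl_weight y a (x + w))%:E <=
   \int[normal_prob m s]_w (\1_(`]-oo, a]%classic : set R) (x + w))%:E)%E.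
Proof.
move=> ay yx.
under eq_integral do rewrite refl_weightD.
under [leRHS]eq_integral do rewrite indicD.
rewrite integral_refl_weight; apply: ge0_le_integral => //.
- by move=> w _; rewrite lee_fin bridge_weight_ge0.
- by apply/measurable_EFinP; exact: measurable_bridge_weight.
- by apply/measurable_EFinP; exact: measurable_indic.
- by move=> w _; rewrite lee_fin bridge_weight_le// ?lerD2r// subr_ge0.
Qed.

End gaussian_reflection.

(** * Reflection along a time grid *)

Section independent_integral.
Local Open Scope ereal_scope.
Context d d1 d2 (T : measurableType d) (T1 : measurableType d1)
  (T2 : measurableType d2) (R : realType).
Variables (P : probability T R) (nu : probability T2 R).
Variables (X : {mfun T >-> T1}) (V : {mfun T >-> T2}).
Hypothesis indep : forall A1 A2, measurable A1 -> measurable A2 ->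
  P (X @^-1` A1 `&` V @^-1` A2) = P (X @^-1` A1) * nu A2.

(** [nu] is the law of [V], as [A1 := setT] shows; it is a separate parameter so that the inner
    integral is taken against an explicit normal law. *)
Lemma ge0_integral_indep (f : T1 * T2 -> \bar R) :
  measurable_fun setT f -> (forall z, 0 <= f z) ->
  \int[P]_w f (X w, V w) = \int[P]_w fubini_F nu f (X w).
Proof.
move=> mf f0.
have mXV : measurable_fun setT (fun w => (X w, V w)).
  by apply: measurable_fun_pair; exact: measurable_funP.
rewrite -(ge0_integral_image P mXV)//.
rewrite (eq_measure_integral (distribution P X \x nu)); last first.
  move=> A mA _; apply/esym; apply: product_measure_unique => //.
rewrite fubini_tonelli1// ge0_integral_distribution//.
- exact: measurable_fun_fubini_tonelli_F.
- by move=> x; apply: integral_ge0.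
Qed.

End independent_integral.

Section fatou_set.
Local Open Scope ereal_scope.
Context d (T : measurableType d) (R : realType).
Variable (m : {measure set T -> \bar R}).

Lemma limn_einf_ge0 (u : (\bar R)^nat) : (forall n, 0 <= u n) -> 0 <= limn_einf u.
Proof.
move=> u0; rewrite limn_einf_lim; apply: lime_ge.
  exact: is_cvg_einfs.
by apply: nearW => n; apply: le_ereal_inf_tmp => _ [k _ <-].
Qed.

Lemma limn_einf_le_cst (u : (\bar R)^nat) c : (forall n, u n <= c) -> limn_einf u <= c.
Proof.
move=> uc; rewrite limn_einf_lim; apply: lime_le.
  exact: is_cvg_einfs.
by apply: nearW => n; apply: ge_ereal_inf; exists (u n) => //; exists n => /=.
Qed.

(** Fatou's lemma for the restrictions of [f] to [F n], which at almost every point of [E] are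
    eventually equal to [f]. This is how the bounds along a grid pass to continuous time. *)
Lemma integral_eventually_le (f : T -> \bar R) (E : set T) (F : (set T)^nat) (c : \bar R) :
  measurable_fun setT f -> (forall w, 0 <= f w) ->
  measurable E -> (forall n, measurable (F n)) ->
  {ae m, forall w, E w -> \forall n \near \oo, F n w} ->
  (forall n, \int[m]_(w in F n) f w <= c) ->
  \int[m]_(w in E) f w <= c.
Proof.
move=> mf f0 mE mF EF Fc.
have mg n : measurable_fun setT (fun w => (f \_ (F n)) w).
  by apply/(measurable_restrictT _ _).1 => //; exact: measurable_funTS.
have g0 n w : 0 <= (f \_ (F n)) w by rewrite patchE; case: ifPn.
apply: (@le_trans _ _ (\int[m]_w limn_einf (fun n => (f \_ (F n)) w))).
  rewrite integral_mkcond; apply: ae_ge0_le_integral => //.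
  - by move=> w _; rewrite patchE; case: ifPn.
  - by apply/(measurable_restrictT _ _).1 => //; exact: measurable_funTS.
  - move=> w _; apply: limn_einf_ge0 => n; exact: g0.
  - rewrite /limn_einf; apply: measurableT_comp => //.
    apply: measurable_fun_limn_esup => n.
    by apply: measurableT_comp => //; exact: mg.
  - apply: filterS EF => w EFw _; rewrite patchE; case: ifPn => [|_]; last first.
      by apply: limn_einf_ge0 => n; exact: g0.
    rewrite inE => /EFw Fw.
    have : (fun n => (f \_ (F n)) w) @ \oo --> f w.
      apply: cvg_near_cst; apply: filterS Fw => n Fnw.
      by rewrite patchE mem_set.
    move=> cv; rewrite is_cvg_limn_einfE//; last by apply/cvg_ex; exists (f w).
    by rewrite (cvg_lim _ cv).
apply: (le_trans (fatou _ _ _ _)) => //.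
by apply: limn_einf_le_cst => n; rewrite -integral_mkcond.
Qed.

End fatou_set.

Section discrete_reflection.
Context (R : realType) d (T : measurableType d) (P : probability T R).
Variables (W : R -> {RV P >-> R}) (mu t : R).
Hypotheses (ht : 0 < t) (hW : standard_brownian_motion W).

(** [Y] starts at 0 on every path, whereas [W 0] vanishes only almost surely; it agrees almost
    surely with [drifted W mu] and is a function of increments alone. *)
Definition drifted_increment (r s : R) (w : T) : R := increment W r s w + mu * (s - r).
Local Notation Y := (drifted_increment 0).

Lemma measurable_increment r s : measurable_fun setT (increment W r s).
Proof. exact: measurable_funB. Qed.

Lemma measurable_drifted_increment r s : measurable_fun setT (drifted_increment r s).
Proof. by apply: measurable_funD => //; exact: measurable_increment. Qed.

HB.instance Definition _ r s := isMeasurableFun.Build _ _ _ _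
  (drifted_increment r s) (measurable_drifted_increment r s).

Lemma drifted_incrementD q r s w :
  drifted_increment q s w = drifted_increment q r w + drifted_increment r s w.
Proof. by rewrite /drifted_increment /increment; ring. Qed.

(** The mean is expressed through the standard deviation to fit the shape [mu * s ^+ 2] of the
    Gaussian comparison. *)
Lemma drifted_increment_law r s (A : set R) : 0 <= r -> r < s -> measurable A ->
  P (drifted_increment r s @^-1` A) =
  normal_prob (mu * (Num.sqrt (s - r)) ^+ 2) (Num.sqrt (s - r)) A.
Proof.
move=> r0 rs mA; have sr0 : 0 < Num.sqrt (s - r) by rewrite sqrtr_gt0 subr_gt0.
case: hW => _ _ law _.
have mh : measurable_fun setT (fun x : R => x + mu * (s - r)) by exact: measurable_funD.
have mB : measurable ((fun x => x + mu * (s - r)) @^-1` A).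
  by rewrite -[X in measurable X]setTI; exact: mh.
transitivity (P (increment W r s @^-1` ((fun x => x + mu * (s - r)) @^-1` A))); first by [].
rewrite (law _ _ r0 rs _ mB) (normal_prob_affine _ sr0 mB) (normal_prob_affine _ sr0 mA).
congr (normal_prob 0 1 _).
rewrite predeqE => x /=; rewrite addr0 sqr_sqrtr//.
by rewrite subr_ge0 ltW.
Qed.

Variable N : nat.
Hypothesis N0 : (0 < N)%N.

Definition grid (i : nat) : R := t * i%:R / N%:R.

Let N0' : 0 < N%:R :> R. Proof. by rewrite ltr0n. Qed.

Lemma grid0 : grid 0 = 0. Proof. by rewrite /grid mulr0 mul0r. Qed.

Lemma gridN : grid N = t.
Proof. by rewrite /grid mulfK// gt_eqF. Qed.

Lemma ler_grid i j : (i <= j)%N -> grid i <= grid j.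
Proof. by move=> ij; rewrite ler_pM2r ?invr_gt0// ler_pM2l// ler_nat. Qed.

Lemma ltr_grid i j : (i < j)%N -> grid i < grid j.
Proof. by move=> ij; rewrite ltr_pM2r ?invr_gt0// ltr_pM2l// ltr_nat. Qed.

Lemma grid_ge0 i : 0 <= grid i. Proof. by rewrite -grid0 ler_grid. Qed.

(** A pi-system generating the sigma-algebra of the first [k] grid increments. The constraints are
    indexed by all of [nat], which makes intersections componentwise. *)
Definition past (k : nat) : set (set T) := [set B | exists2 A : nat -> set R,
  (forall i, measurable (A i)) &
  B = \bigcap_(i in `I_k) increment W (grid i) (grid i.+1) @^-1` A i].

Lemma past_setI_closed k : setI_closed (past k).
Proof.
move=> _ _ [A mA ->] [B mB ->]; exists (fun i => A i `&` B i).
  by move=> i; exact: measurableI.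
by rewrite -bigcapI.
Qed.

Lemma past_setT k : past k setT.
Proof.
exists (fun=> setT) => //.
by rewrite predeqE => w; split => // _ i _.
Qed.

Lemma past_measurable k B : past k B -> measurable B.
Proof.
move=> [A mA ->]; apply: bigcap_measurableType => i _.
by rewrite -[X in measurable X]setTI; exact: measurable_increment.
Qed.

Lemma past_sub k : <<s past k >> `<=` measurable.
Proof.
apply: smallest_sub; first exact: sigma_algebra_measurable.
exact: past_measurable.
Qed.

Let past_indep0 k (B : set T) (A : set R) : (k < N)%N -> past k B -> measurable A ->
  P (B `&` increment W (grid k) t @^-1` A) = (P B * P (increment W (grid k) t @^-1` A))%E.
Proof.
move=> kN [A' mA' ->{B}] mA.
have [_ + _ _] := hW.
(* Independence is assumed for consecutive increments, so the grid is cut after [k] and continued by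
   the constant [t]: the increment number [k] is then the one from [grid k] to [t]. *)
pose tt i := if (i <= k)%N then grid i else t.
move=> /(_ tt k.+1).
have t0 : 0 <= tt 0%N by rewrite /tt leq0n grid0.
have tm i : tt i <= tt i.+1.
  rewrite /tt; have [ik|ki] := leqP i.+1 k; first by rewrite (ltnW ik) ler_grid.
  by case: ifPn => // ik; rewrite -gridN ler_grid// (leq_trans ik)// ltnW.
move=> /(_ t0 tm) ind.
pose A2 (C : set R) (i : 'I_k.+1) := if (i < k)%N then A' i else C.
(* The set for the last increment is left free: [C := A] gives the joint probability, and
   [C := setT] identifies the product over the earlier increments with the probability of the past
   event. *)
have E C : measurable C ->
    P ((\bigcap_(i in `I_k) increment W (grid i) (grid i.+1) @^-1` A' i) `&` increment W (grid k) t @^-1` C) =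
    ((\prod_(i < k) P (increment W (grid i) (grid i.+1) @^-1` A' i)) *
     P (increment W (grid k) t @^-1` C))%E.
  move=> mC.
  have /ind : forall i, measurable (A2 C i) by move=> i; rewrite /A2; case: ifPn.
  rewrite big_ord_recr/= /A2 ltnn /tt leqnn ltnn => E.
  transitivity (P (\bigcap_(i in [set: 'I_k.+1]) increment W (tt i) (tt i.+1) @^-1` A2 C i)).
    congr (P _); rewrite predeqE => w; split.
      move=> [h1 h2] i _; rewrite /A2 /tt.
      have := ltn_ord i; rewrite ltnS leq_eqVlt => /predU1P[->|ik].
        by rewrite eqxx /= ltnn.
      by rewrite ik orbT; exact: h1.
    move=> h; split.
      move=> i /= ik; have /= := h (Ordinal (leq_trans ik (leqnSn k))) Logic.I.
      by rewrite /A2 /tt/= ik (ltnW ik).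
    have /= := h (Ordinal (ltnSn k)) Logic.I.
    by rewrite /A2 /tt/= leqnn ltnn.
  rewrite E; congr (_ * _)%E; apply: eq_bigr => i _.
  by rewrite /= ltn_ord (ltnW (ltn_ord i)).
rewrite (E _ mA); congr (_ * _)%E.
have := E _ measurableT.
by rewrite preimage_setT setIT probability_setT mule1.
Qed.

(** As functions of [B] both sides are finite measures, a restriction of [P] and a multiple of [P],
    and they agree on the pi-system [past k]. *)
Lemma past_indep k (B : set T) (A : set R) : (k < N)%N -> <<s past k >> B -> measurable A ->
  P (B `&` increment W (grid k) t @^-1` A) = (P B * P (increment W (grid k) t @^-1` A))%E.
Proof.
move=> kN sB mA.
have mS : measurable (increment W (grid k) t @^-1` A).
  by rewrite -[X in measurable X]setTI; exact: measurable_increment.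
have Pfin : P (increment W (grid k) t @^-1` A) \is a fin_num by rewrite fin_num_measure.
have c0 : 0 <= fine (P (increment W (grid k) t @^-1` A)) by rewrite fine_ge0.
rewrite muleC -[in RHS](fineK Pfin).
apply: (g_sigma_algebra_measure_unique (past k) _ (fun=> setT) _ _
  (mrestr P mS) (mscale (NngNum c0) P)) => //.
- exact: past_measurable.
- by move=> _; exact: past_setT.
- by rewrite bigcup_const.
- exact: past_setI_closed.
- move=> C pC; transitivity (P (C `&` increment W (grid k) t @^-1` A)); first by [].
  transitivity ((fine (P (increment W (grid k) t @^-1` A)))%:E * P C)%E; last by [].
  by rewrite fineK// muleC past_indep0.
- by move=> _; rewrite /= /mrestr setTI ltey_eq Pfin.
Qed.

Lemma past_measurable_increment k i : (i < k)%N ->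
  @measurable_fun _ _ (g_sigma_algebraType (past k)) R setT
    (increment W (grid i) (grid i.+1)).
Proof.
move=> ik _ A mA; rewrite setTI; apply: sub_sigma_algebra.
exists (fun j => if j == i then A else setT).
  by move=> j; case: ifPn.
rewrite predeqE => w; split => [Aw j /= jk|/(_ i ik)/=].
  by case: eqVneq => // ->.
by rewrite eqxx.
Qed.

Lemma past_measurable_Y k i : (i <= k)%N ->
  @measurable_fun _ _ (g_sigma_algebraType (past k)) R setT (Y (grid i)).
Proof.
elim: i => [_|i ih ik].
  rewrite (_ : Y (grid 0) = cst 0)//.
  by apply/funext => w; rewrite /drifted_increment /increment grid0 !subrr mulr0 addr0.
rewrite (_ : Y (grid i.+1) = (fun w => Y (grid i) w + (increment W (grid i) (grid i.+1) w + mu * (grid i.+1 - grid i)))).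
  apply: measurable_funD; first by exact: ih (ltnW ik).
  by apply: measurable_funD => //; exact: past_measurable_increment.
by apply/funext => w; rewrite (drifted_incrementD 0 (grid i)).
Qed.

End discrete_reflection.

Section first_hit.
Context (R : realType) d (T : measurableType d) (P : probability T R).
Variables (W : R -> {RV P >-> R}) (mu t : R).
Hypotheses (ht : 0 < t) (hW : standard_brownian_motion W).
Variable N : nat.
Hypothesis N0 : (0 < N)%N.
Local Notation Y := (drifted_increment W mu 0).
Local Notation past := (past W t N).
Local Notation grid := (grid t N).

(** The Markov property at the deterministic time [grid k]. *)
Lemma integral_past k (B : set T) (g : R -> R) : (k < N)%N -> <<s past k >> B ->
  measurable_fun setT g -> (forall x, 0 <= g x) ->
  (\int[P]_(w in B) (g (Y t w))%:E =
   \int[P]_w ((\1_B w)%:E *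
     \int[normal_law (mu * (Num.sqrt (t - grid k)) ^+ 2) (Num.sqrt (t - grid k))]_v
       (g (Y (grid k) w + v))%:E))%E.
Proof.
move=> kN sB mg g0.
have mB : measurable B by exact: past_sub sB.
have gkt : grid k < t by rewrite -[X in _ < X](gridN t N0) ltr_grid.
pose sg := Num.sqrt (t - grid k).
pose nu := normal_law (mu * sg ^+ 2) sg.
(* The indicator of [B] is carried along with the position, so that everything known at time
   [grid k] forms one variable independent of [V]. *)
pose Xf w := (\1_B w : R, Y (grid k) w).
have mX : measurable_fun setT Xf.
  by apply: measurable_fun_pair; [exact: measurable_indic|exact: measurable_funP].
pose X : {mfun T >-> (R * R)%type} := HB.pack Xf (isMeasurableFun.Build _ _ _ _ Xf mX).
pose V : {mfun T >-> R} := drifted_increment W mu (grid k) t.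
have XV (A1 : set (R * R)) (A2 : set R) : measurable A1 -> measurable A2 ->
    P (X @^-1` A1 `&` V @^-1` A2) = (P (X @^-1` A1) * nu A2)%E.
  move=> mA1 mA2.
  have sX : <<s past k >> (X @^-1` A1).
    have mX' : @measurable_fun _ _ (g_sigma_algebraType (past k)) (R * R)%type setT Xf.
      apply: measurable_fun_pair; last exact: past_measurable_Y.
      exact: (@measurable_indic _ (g_sigma_algebraType (past k)) R setT B sB).
    by rewrite -[X in <<s _ >> X]setTI; exact: mX'.
  have mh : measurable_fun setT (fun x : R => x + mu * (t - grid k)) by exact: measurable_funD.
  have mC : measurable ((fun x => x + mu * (t - grid k)) @^-1` A2).
    by rewrite -[X in measurable X]setTI; exact: mh.
  have VE : V @^-1` A2 = increment W (grid k) t @^-1` ((fun x => x + mu * (t - grid k)) @^-1` A2) by [].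
  rewrite [in LHS]VE (past_indep ht hW N0 kN sX mC) -VE; congr (_ * _)%E.
  by rewrite /V drifted_increment_law// grid_ge0.
(* The absolute value makes [f] nonnegative on the whole space; the first coordinate will be an
   indicator, on which it acts trivially. *)
pose f (z : (R * R) * R) : \bar R := (`|z.1.1| * g (z.1.2 + z.2))%:E.
have mf : measurable_fun setT f.
  apply/measurable_EFinP; apply: measurable_funM.
    apply: measurableT_comp => //.
    by apply: (measurableT_comp (f := fst)) => //; exact: measurable_fst.
  apply: measurableT_comp => //; apply: measurable_funD => //.
  by apply: (measurableT_comp (f := snd)) => //; exact: measurable_fst.
have f0 z : (0 <= f z)%E by rewrite lee_fin mulr_ge0.
transitivity (\int[P]_w f (X w, V w))%E.
  rewrite integral_mkcond; apply: eq_integral => w _.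
  rewrite patchE /f /= -drifted_incrementD indicE.
  by case: ifPn => _ /=; rewrite ?normr1 ?mul1r// normr0 mul0r.
rewrite (@ge0_integral_indep _ _ _ _ _ _ _ P nu X V XV f mf f0); apply: eq_integral => w _.
rewrite /fubini_F /f /=.
have -> : `|\1_B w| = \1_B w :> R by rewrite ger0_norm.
under eq_integral do rewrite EFinM.
rewrite ge0_integralZl//.
- apply/measurable_EFinP; apply: measurableT_comp => //.
  exact: measurable_funD.
- by move=> x _; rewrite lee_fin.
Qed.

Variables (a y : R).
Hypothesis ay : a <= y.

Let I (x : R) : R := \1_(`]-oo, a]%classic : set R) x.
Let mI : measurable_fun setT I. Proof. exact: measurable_indic. Qed.
Let I0 x : 0 <= I x. Proof. by []. Qed.
Let Rw (x : R) : R := refl_weight mu y a x.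
Let mR : measurable_fun setT Rw. Proof. exact: measurable_refl_weight. Qed.
Let R0 x : 0 <= Rw x. Proof. exact: refl_weight_ge0. Qed.

Let mterm k (B : set T) (g : R -> R) (mB : measurable B) : measurable_fun setT g -> (forall x, 0 <= g x) ->
  measurable_fun setT (fun w => ((\1_B w)%:E *
     \int[normal_law (mu * (Num.sqrt (t - grid k)) ^+ 2) (Num.sqrt (t - grid k))]_v
       (g (Y (grid k) w + v))%:E)%E).
Proof.
move=> mg g0; apply: emeasurable_funM; first by apply/measurable_EFinP; exact: measurable_indic.
pose nu := normal_law (mu * (Num.sqrt (t - grid k)) ^+ 2) (Num.sqrt (t - grid k)).
pose f (z : R * R) := (g (z.1 + z.2))%:E.
have mf : measurable_fun setT f.
  apply/measurable_EFinP; apply: measurableT_comp => //.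
  exact: measurable_funD.
have mF := @measurable_fun_fubini_tonelli_F _ _ _ _ _ nu f mf (fun z => g0 _).
by apply: measurableT_comp mF _; exact: measurable_drifted_increment.
Qed.

(** For [k < N] the Markov property reduces this to the Gaussian comparison from the start
    [Y (grid k) w]. For [k = N] no increment is left, and the indicator vanishes on [B] because
    [a <= y]. *)
Lemma first_hit_above k (B : set T) : (k <= N)%N -> <<s past k >> B ->
  (forall w, B w -> y < Y (grid k) w) ->
  (\int[P]_(w in B) (I (Y t w))%:E <= \int[P]_(w in B) (Rw (Y t w))%:E)%E.
Proof.
move=> kN sB By; have mB : measurable B by exact: past_sub sB.
move: kN; rewrite leq_eqVlt => /predU1P[kN|kN].
  apply: ge0_le_integral => //.
  - by move=> w _; rewrite lee_fin.
  - by apply/measurable_EFinP/measurable_funTS; apply: measurableT_comp => //; exact: measurable_drifted_increment.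
  - by apply/measurable_EFinP/measurable_funTS; apply: measurableT_comp => //; exact: measurable_drifted_increment.
  - move=> w /By; rewrite kN gridN// => yY; rewrite lee_fin.
    rewrite {1}/I indicE memNset ?R0//= in_itv/= => Ya.
    by move: (le_lt_trans (le_trans Ya ay) yY); rewrite ltxx.
rewrite (integral_past kN sB mI I0) (integral_past kN sB mR R0); apply: ge0_le_integral => //.
- by move=> w _; rewrite mule_ge0 ?lee_fin// integral_ge0// => x _; rewrite lee_fin.
- exact: mterm.
- exact: mterm.
move=> w _; rewrite indicE; have [wB|] := boolP (w \in B); last by rewrite !mul0e.
rewrite !mul1e !ge0_integral_normal_law; last 4 first.
- by apply/measurable_EFinP; apply: measurableT_comp => //; exact: measurable_funD.
- by move=> x; rewrite lee_fin.
- by apply/measurable_EFinP; apply: measurableT_comp => //; exact: measurable_funD.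
- by move=> x; rewrite lee_fin.
apply: le_integral_refl => //; last by apply/ltW/By; exact: set_mem.
by rewrite sqrtr_gt0 subr_gt0 -[X in _ < X](gridN t N0) ltr_grid.
Qed.

Lemma first_hit_below k (B : set T) : (k <= N)%N -> <<s past k >> B ->
  (forall w, B w -> Y (grid k) w < y) ->
  (\int[P]_(w in B) (Rw (Y t w))%:E <= \int[P]_(w in B) (I (Y t w))%:E)%E.
Proof.
move=> kN sB By; have mB : measurable B by exact: past_sub sB.
(* At the final time it is the weight that vanishes: its support begins at 2 y - a, which is at
   least y. *)
move: kN; rewrite leq_eqVlt => /predU1P[kN|kN].
  apply: ge0_le_integral => //.
  - by move=> w _; rewrite lee_fin.
  - by apply/measurable_EFinP/measurable_funTS; apply: measurableT_comp => //; exact: measurable_drifted_increment.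
  - by apply/measurable_EFinP/measurable_funTS; apply: measurableT_comp => //; exact: measurable_drifted_increment.
  - move=> w /By; rewrite kN gridN// => yY; rewrite lee_fin.
    rewrite {1}/Rw /refl_weight indicE memNset ?mulr0//= in_itv/= andbT => Ya.
    have : y <= 2 * y - a by rewrite mulr_natl mulr2n -addrA lerDl subr_ge0.
    by move=> /le_trans /(_ Ya) /le_lt_trans /(_ yY); rewrite ltxx.
rewrite (integral_past kN sB mR R0) (integral_past kN sB mI I0); apply: ge0_le_integral => //.
- by move=> w _; rewrite mule_ge0 ?lee_fin// integral_ge0// => x _; rewrite lee_fin.
- exact: mterm.
- exact: mterm.
move=> w _; rewrite indicE; have [wB|] := boolP (w \in B); last by rewrite !mul0e.
rewrite !mul1e !ge0_integral_normal_law; last 4 first.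
- by apply/measurable_EFinP; apply: measurableT_comp => //; exact: measurable_funD.
- by move=> x; rewrite lee_fin.
- by apply/measurable_EFinP; apply: measurableT_comp => //; exact: measurable_funD.
- by move=> x; rewrite lee_fin.
apply: integral_refl_le => //; last by apply/ltW/By; exact: set_mem.
by rewrite sqrtr_gt0 subr_gt0 -[X in _ < X](gridN t N0) ltr_grid.
Qed.

(* The set is cut according to the first [k] with [O (Y (grid k) w)], an event
   determined by the increments before [grid k]. *)
Definition grid_hit (O : set R) : set T := [set w | exists2 k, (k <= N)%N & O (Y (grid k) w)].

(** Empty beyond [N], so that [seqDU] and countable additivity apply to what is a finite family. *)
Let hit (O : set R) k : set T := if (k <= N)%N then Y (grid k) @^-1` O else set0.

Let grid_hitE O : grid_hit O = \bigcup_k seqDU (hit O) k.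
Proof.
rewrite -seqDU_bigcup_eq predeqE => w; split=> [[k kN Ok]|[k _]].
  by exists k => //; rewrite /hit kN.
by rewrite /hit; case: ifPn => // kN Ok; exists k.
Qed.

Let past_hit O k : measurable O -> (k <= N)%N -> <<s past k >> (seqDU (hit O) k).
Proof.
move=> mO kN.
have mh j : (j <= k)%N -> @measurable _ (g_sigma_algebraType (past k)) (hit O j).
  move=> jk; rewrite /hit (leq_trans jk kN) -[X in measurable X]setTI.
  have mY : @measurable_fun _ _ (g_sigma_algebraType (past k)) R setT (Y (grid j)).
    exact: past_measurable_Y.
  exact: (mY measurableT O mO).
rewrite /seqDU.
have : @measurable _ (g_sigma_algebraType (past k)) (hit O k `\` \big[setU/set0]_(j < k) hit O j).
  apply: measurableD; first exact: mh.
  by apply: bigsetU_measurable => j _; apply: mh; exact: ltnW.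
by [].
Qed.

Let measurable_hit O k : measurable O -> measurable (seqDU (hit O) k).
Proof.
move=> mO; have [kN|Nk] := leqP k N; first exact: past_sub (past_hit mO kN).
by rewrite /seqDU /hit leqNgt Nk/= set0D.
Qed.

Lemma measurable_grid_hit O : measurable O -> measurable (grid_hit O).
Proof.
by move=> mO; rewrite grid_hitE; apply: bigcupT_measurable => k; exact: measurable_hit.
Qed.

Let grid_hit_le O (f g : T -> R) : measurable O ->
  measurable_fun setT f -> measurable_fun setT g ->
  (forall w, 0 <= f w) -> (forall w, 0 <= g w) ->
  (forall k, (k <= N)%N -> (\int[P]_(w in seqDU (hit O) k) (f w)%:E <=
    \int[P]_(w in seqDU (hit O) k) (g w)%:E)%E) ->
  (\int[P]_(w in grid_hit O) (f w)%:E <= \int[P]_(w in grid_hit O) (g w)%:E)%E.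
Proof.
move=> mO mf mg f0 g0 fg; rewrite grid_hitE.
have mH k : measurable (seqDU (hit O) k) by exact: measurable_hit.
have mHU : measurable (\bigcup_k seqDU (hit O) k) by exact: bigcupT_measurable.
rewrite (@ge0_integral_bigcup _ _ _ P _ _ mH _ _ (@trivIset_seqDU _ _)); last 2 first.
- by apply/measurable_EFinP; exact: measurable_funTS.
- by move=> w _; rewrite lee_fin.
rewrite (@ge0_integral_bigcup _ _ _ P _ _ mH _ _ (@trivIset_seqDU _ _)); last 2 first.
- by apply/measurable_EFinP; exact: measurable_funTS.
- by move=> w _; rewrite lee_fin.
apply: lee_nneseries => [k _ _|k _].
  by apply: integral_ge0 => w _; rewrite lee_fin.
have [kN|Nk] := leqP k N; first exact: fg.
by rewrite /seqDU /hit leqNgt Nk/= set0D !integral_set0.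
Qed.

Lemma grid_hit_above (O : set R) : measurable O -> O `<=` `]y, +oo[%classic ->
  (\int[P]_(w in grid_hit O) (I (Y t w))%:E <= \int[P]_(w in grid_hit O) (Rw (Y t w))%:E)%E.
Proof.
move=> mO Oy; apply: grid_hit_le => //.
- by apply: measurableT_comp => //; exact: measurable_drifted_increment.
- by apply: measurableT_comp => //; exact: measurable_drifted_increment.
move=> k kN; apply: (first_hit_above kN (past_hit mO kN)) => w [+ _].
by rewrite /hit kN => /Oy /=; rewrite in_itv/= andbT.
Qed.

Lemma grid_hit_below (O : set R) : measurable O -> O `<=` `]-oo, y[%classic ->
  (\int[P]_(w in grid_hit O) (Rw (Y t w))%:E <= \int[P]_(w in grid_hit O) (I (Y t w))%:E)%E.
Proof.
move=> mO Oy; apply: grid_hit_le => //.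
- by apply: measurableT_comp => //; exact: measurable_drifted_increment.
- by apply: measurableT_comp => //; exact: measurable_drifted_increment.
move=> k kN; apply: (first_hit_below kN (past_hit mO kN)) => w [+ _].
by rewrite /hit kN => /Oy /=; rewrite in_itv.
Qed.

End first_hit.

(** * Quantile functions and the normal distribution function *)

Section derivative_facts.
Context {R : realType}.

Lemma is_derive_continuous (f : R -> R) (x df : R) : is_derive x 1 f df -> {for x, continuous f}.
Proof.
by move=> [dfx _]; apply: differentiable_continuous; exact/derivable1_diffP.
Qed.

Lemma derive1_is_derive (f : R -> R) (x df : R) :
  derivable f x 1 -> f^`()%classic x = df -> is_derive x 1 f df.
Proof. by move=> fx <-; rewrite derive1E; exact: derivableP. Qed.

Lemma gt0_is_derive_lt (f f' : R -> R) (a b : R) : a < b -> continuous f ->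
  (forall x, a < x < b -> is_derive x 1 f (f' x)) ->
  (forall x, a < x < b -> 0 < f' x) -> f a < f b.
Proof.
move=> ab cf df f'0.
have dfi x : x \in `]a, b[ -> is_derive x 1 f (f' x).
  by rewrite in_itv/=; exact: df.
have [c] := MVT ab dfi (continuous_subspaceT cf).
rewrite in_itv/= => cab E; rewrite -subr_gt0 E mulr_gt0 ?subr_gt0//.
exact: f'0.
Qed.

End derivative_facts.

Section quantile_facts.
Context {R : realType}.
Variable F : R -> R.
Hypotheses (Fc : continuous F) (Fnd : {homo F : x y / x <= y}).
Hypotheses (F0 : F x @[x --> -oo] --> (0 : R)) (F1 : F x @[x --> +oo] --> (1 : R)).

Lemma cdf_lt u : 0 < u -> exists x, F x < u.
Proof.
move=> u0; have /cvgr_lt/(_ _ u0) := F0.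
by move=> [M [_ h]]; exists (M - 1); apply: h; rewrite ltrBlDr ltrDl.
Qed.

Lemma cdf_gt u : u < 1 -> exists x, u < F x.
Proof.
move=> u0; have /cvgr_gt/(_ _ u0) := F1.
by move=> [M [_ h]]; exists (M + 1); apply: h; rewrite ltrDl.
Qed.

Lemma cdf_surj u : 0 < u < 1 -> exists x, F x = u.
Proof.
move=> /andP[/cdf_lt[x xu] /cdf_gt[y uy]].
have xy : x <= y.
  by rewrite leNgt; apply/negP => /ltW/Fnd; rewrite leNgt (lt_trans xu uy).
have [|c _ cE] := IVT xy (continuous_subspaceT Fc) (v := u); last by exists c.
by rewrite (min_idPl (Fnd xy)) (max_idPr (Fnd xy)) !ltW.
Qed.

Let has_inf_quantile u : 0 < u < 1 -> has_inf [set x | u <= F x].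
Proof.
move=> /andP[/cdf_lt[x xu] /cdf_gt[y uy]]; split; first by exists y; exact: ltW.
exists x => z /= uz; rewrite leNgt; apply/negP => /ltW/Fnd.
by rewrite leNgt (lt_le_trans xu uz).
Qed.

Lemma quantileK u : 0 < u < 1 -> F (quantile F u) = u.
Proof.
move=> u01; have hq := has_inf_quantile u01.
apply/eqP; rewrite eq_le; apply/andP; split.
  have [x xu] := cdf_surj u01; rewrite -[leRHS]xu; apply: Fnd.
  by apply: ge_inf; [exact: hq.2|rewrite /= xu].
rewrite leNgt; apply/negP => Fqu.
have /cvgr_lt/(_ _ Fqu) := Fc (x := quantile F u).
move=> /nbhs_ballP[e /= e0 be].
have [x /= ux xq] := inf_adherent e0 hq.
have : F x < u.
  apply: be; rewrite /ball/= distrC ger0_norm ?ltrBlDl//.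
  by rewrite subr_ge0; apply: ge_inf; [exact: hq.2|].
by rewrite ltNge ux.
Qed.

Lemma quantile_le u x : 0 < u < 1 -> (quantile F u <= x) = (u <= F x).
Proof.
move=> u01; apply/idP/idP => [/Fnd|ux]; first by rewrite quantileK.
by apply: ge_inf; [exact: (has_inf_quantile u01).2|].
Qed.

(** The infimum selects the left end of a level set, so strict increase to the left of [x] is
    enough. *)
Lemma quantile_cdf x : 0 < F x < 1 -> (forall z, z < x -> F z < F x) ->
  quantile F (F x) = x.
Proof.
move=> x01 xs; apply/eqP; rewrite eq_le quantile_le// lexx/= leNgt.
by apply/negP => /xs; rewrite quantileK// ltxx.
Qed.

Lemma measurable_quantile : measurable_fun (`]0, 1[%classic : set R) (quantile F).
Proof.
apply: (measurability _ measurable_itvNyc) => _ [_ [x ->] <-].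
rewrite (_ : _ `&` _ = `]0, 1[%classic `&` `]-oo, F x]%classic); first exact: measurableI.
rewrite predeqE => u /=; rewrite !in_itv/=; split=> -[u01].
  by rewrite quantile_le.
by rewrite -quantile_le.
Qed.

End quantile_facts.

Section Phi_facts.
Context {R : realType}.
Local Notation leb := (@lebesgue_measure R).

Lemma phi_gt0 (x : R) : 0 < phi x.
Proof. by rewrite /phi normal_pdf_exp// mulr_gt0 ?normal_peak_gt0 ?expR_gt0. Qed.

Lemma continuous_phi : continuous (@phi R).
Proof. exact: continuous_normal_pdf. Qed.

Lemma is_derive_Phi (x : R) : is_derive x 1 Phi (phi x).
Proof.
have := @continuous_FTC1 R phi -oo%O x (x + 1).
rewrite ltrDl ltr01 => /(_ isT).
have i1 : leb.-integrable [set` Interval -oo%O (BRight (x + 1))] (EFin \o phi).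
  apply: (@integrableS _ _ _ _ setT) => //; exact: integrable_normal_pdf.
move=> /(_ i1) /= /(_ _ (@continuous_phi x)) [|d1 E]; first exact: ltNyr.
have -> : @Phi R = (fun x => \int[leb]_(t in `]-oo, x]) phi t) by [].
exact: derive1_is_derive d1 E.
Qed.

Lemma continuous_Phi : continuous (@Phi R).
Proof. by move=> x; apply: is_derive_continuous; exact: is_derive_Phi. Qed.

Lemma ltr_Phi (x y : R) : x < y -> Phi x < Phi y.
Proof.
move=> xy; apply: (gt0_is_derive_lt xy continuous_Phi) => z _.
  exact: is_derive_Phi.
exact: phi_gt0.
Qed.

Lemma ltr_PhiE : {mono (@Phi R) : x y / x < y}.
Proof. by apply: leW_mono; apply: le_mono; exact: ltr_Phi. Qed.

Lemma ler_PhiE : {mono (@Phi R) : x y / x <= y}.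
Proof. by apply: le_mono; exact: ltr_Phi. Qed.

Let idf : R -> R := idfun.
Let measurable_idf : measurable_fun setT idf. Proof. exact: measurable_id. Qed.
Let id_law : {mfun R >-> R} := HB.pack idf (isMeasurableFun.Build _ _ _ _ idf measurable_idf).

Lemma Phi_cvgy1 : Phi x @[x --> +oo%R] --> (1 : R).
Proof.
exact/fine_cvg/(cvg_cdfy1 (id_law : {RV (normal_law 0 1) >-> R})).
Qed.

Lemma Phi_cvgNy0 : Phi x @[x --> -oo%R] --> (0 : R).
Proof.
exact/fine_cvg/(cvg_cdfNy0 (id_law : {RV (normal_law 0 1) >-> R})).
Qed.

Lemma Phi_ge0 (x : R) : 0 <= Phi x.
Proof. by rewrite -lee_fin PhiE. Qed.

Lemma Phi_le1 (x : R) : Phi x <= 1.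
Proof. by rewrite -lee_fin PhiE probability_le1. Qed.

Lemma Phi_gt0 (x : R) : 0 < Phi x.
Proof. by apply: (le_lt_trans (Phi_ge0 (x - 1))); apply: ltr_Phi; rewrite ltrBlDr ltrDl. Qed.

Lemma Phi_lt1 (x : R) : Phi x < 1.
Proof. by apply: (lt_le_trans _ (Phi_le1 (x + 1))); apply: ltr_Phi; rewrite ltrDl. Qed.

Lemma Phi_homo : {homo (@Phi R) : x y / x <= y}.
Proof. by move=> x y; rewrite ler_PhiE. Qed.

Lemma quantile_PhiK (u : R) : 0 < u < 1 -> Phi (quantile Phi u) = u.
Proof.
exact: (quantileK continuous_Phi Phi_homo Phi_cvgNy0 Phi_cvgy1).
Qed.

Lemma quantile_Phi (x : R) : quantile Phi (Phi x) = x.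
Proof.
apply: (quantile_cdf continuous_Phi Phi_homo Phi_cvgNy0 Phi_cvgy1).
- by rewrite Phi_gt0 Phi_lt1.
- by move=> z; rewrite ltr_PhiE.
Qed.

End Phi_facts.

(** * Joint law of the endpoint and the maximum *)

Section joint_law.
Context (R : realType) d (T : measurableType d) (P : probability T R).
Variables (W : R -> {RV P >-> R}) (mu t : R) (M : {RV P >-> R}).
Hypotheses (ht : 0 < t) (hW : standard_brownian_motion W).
Hypothesis hM : running_max (drifted W mu) t M.
Local Notation Y := (drifted_increment W mu 0).

Lemma path_grid_hit w (O : set R) s : {within `[0, +oo[, continuous (fun s => W s w)} ->
  open O -> 0 <= s <= t -> O (Y s w) ->
  \forall n \near \oo, grid_hit W mu t n.+1 O w.
Proof.
move=> cW oO /andP[s0 st] OYs.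
have cs : Y r w @[r --> within `[0, +oo[%classic (nbhs s)] --> Y s w.
  rewrite /drifted_increment /increment.
  apply: cvgD; last first.
    apply: cvgM; first exact: cvg_cst.
    apply: cvgB; last exact: cvg_cst.
    exact: cvg_within.
  apply: cvgB; last exact: cvg_cst.
  move/subspace_continuousP : cW => /(_ s); apply.
  by rewrite /= in_itv/= andbT.
have /cs : nbhs (Y s w) O by exact: open_nbhs_nbhs.
move=> /nbhs_ballP[e /= e0 be].
(* From index [m] on the mesh is below [e], the radius on which the path stays in [O]. *)
pose m := (Num.truncn (t / e)).+1.
have tm : t / e < m%:R by exact: truncnS_gt.
exists m => // n /= mn.
have n0 : 0 < n.+1%:R :> R by rewrite ltr0n.
have tn : t / n.+1%:R < e.
  rewrite ltr_pdivrMr// mulrC -ltr_pdivrMr//; apply: (lt_trans tm).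
  by rewrite ltr_nat.
(* The last grid index at or before [s]; its time lies within one mesh of [s]. *)
pose k := Num.truncn (s * n.+1%:R / t).
have s1 : 0 <= s * n.+1%:R / t by rewrite divr_ge0 ?mulr_ge0// ltW.
have /andP[k1 k2] := truncn_itv s1.
have gk : grid t n.+1 k <= s.
  by rewrite /grid ler_pdivrMr// mulrC -ler_pdivlMr.
have gk' : s < grid t n.+1 k + t / n.+1%:R.
  rewrite /grid -mulrDl -[X in _ + X]mulr1 -mulrDr.
  rewrite ltr_pdivlMr// mulrC [_ * s]mulrC -ltr_pdivrMl// mulrC.
  have -> : t^-1 * (n.+1%:R * s) = s * n.+1%:R / t by rewrite mulrC [X in X / t]mulrC.
  by rewrite natr1.
exists k.
  rewrite -(ler_nat R); apply: (le_trans k1).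
  by rewrite ler_pdivrMr// mulrC ler_pM2l.
apply: be; last by rewrite in_itv/= andbT grid_ge0.
rewrite /ball/= ger0_norm ?subr_ge0//.
by rewrite ltrBlDr (lt_trans gk')// addrC ltrD2r.
Qed.

Lemma path_ae : {ae P, forall w, [/\ {within `[0, +oo[, continuous (fun s => W s w)},
  (exists2 s, 0 <= s <= t & M w = Y s w),
  (forall s, 0 <= s <= t -> Y s w <= M w) & drifted W mu t w = Y t w]}.
Proof.
have [W0 _ _ cW] := hW.
apply: filterS3 hM W0 cW => w [[s st MX] XM] W0w cWw.
have E r : drifted W mu r w = Y r w.
  by rewrite /drifted_increment /increment /drifted W0w !subr0.
split => //; first by exists s => //; rewrite -E.
by move=> r rt; rewrite -E; exact: XM.
Qed.

Let mY : measurable_fun setT (Y t). Proof. exact: measurable_drifted_increment. Qed.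

Let mI a : measurable_fun setT (fun w => (\1_(`]-oo, a]%classic : set R) (Y t w) : R)%:E).
Proof.
by apply/measurable_EFinP; apply: measurableT_comp => //; exact: measurable_indic.
Qed.

Let mR a y : measurable_fun setT (fun w => (refl_weight mu y a (Y t w))%:E).
Proof.
by apply/measurable_EFinP; apply: measurableT_comp => //; exact: measurable_refl_weight.
Qed.

Let mgt (X : T -> R) y : measurable_fun setT X -> measurable (X @^-1` `]y, +oo[%classic).
Proof. by move=> mX; rewrite -[X in measurable X]setTI; exact: mX. Qed.

Lemma integral_refl_weight_Y a y :
  (\int[P]_w (refl_weight mu y a (Y t w))%:E =
   (expR (2 * mu * y) * Phi ((a - 2 * y - mu * t) / Num.sqrt t))%:E)%E.
Proof.
have st0 : 0 < Num.sqrt t by rewrite sqrtr_gt0.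
rewrite -(ge0_integral_image P mY (g := fun x => (refl_weight mu y a x)%:E)); last 2 first.
- by apply/measurable_EFinP; exact: measurable_refl_weight.
- by move=> x; rewrite lee_fin refl_weight_ge0.
rewrite (eq_measure_integral (normal_law (mu * (Num.sqrt t) ^+ 2) (Num.sqrt t))); last first.
  move=> A mA _.
  change (P (Y t @^-1` A) = normal_prob (mu * (Num.sqrt t) ^+ 2) (Num.sqrt t) A).
  by have := drifted_increment_law mu hW (lexx 0) ht mA; rewrite subr0.
rewrite ge0_integral_normal_law; last 2 first.
- by apply/measurable_EFinP; exact: measurable_refl_weight.
- by move=> x; rewrite lee_fin refl_weight_ge0.
by rewrite integral_refl_weight// integral_bridge_weight// sqr_sqrtr// ltW.
Qed.

Lemma integral_max_above a y : a <= y ->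
  (\int[P]_(w in M @^-1` `]y, +oo[%classic) (\1_(`]-oo, a]%classic : set R) (Y t w))%:E <=
   \int[P]_w (refl_weight mu y a (Y t w))%:E)%E.
Proof.
move=> ay; pose O := `]y, +oo[%classic : set R.
have mO : measurable O by exact: measurable_itv.
apply: (@integral_eventually_le _ _ _ _ _ _ (fun n => grid_hit W mu t n.+1 O)) => //.
- exact: mgt.
- by move=> n; exact: measurable_grid_hit.
- apply: filterS path_ae => w [cW [s st Ms] _ _]; rewrite /= in_itv/= andbT => yM.
  apply: (path_grid_hit cW _ st); first exact: interval_open.
  by rewrite /O/= in_itv/= andbT -Ms.
- move=> n; apply: (@le_trans _ _ (\int[P]_(w in grid_hit W mu t n.+1 O) (refl_weight mu y a (Y t w))%:E)%E).
    by apply: grid_hit_above.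
  apply: ge0_subset_integral => //; first exact: measurable_grid_hit.
  by move=> w _; rewrite lee_fin refl_weight_ge0.
Qed.

Lemma integral_max_below a y y' : 0 <= y -> a <= y -> y < y' ->
  (\int[P]_w (refl_weight mu y' a (Y t w))%:E <=
   \int[P]_(w in M @^-1` `]y, +oo[%classic) (\1_(`]-oo, a]%classic : set R) (Y t w))%:E)%E.
Proof.
move=> y0 ay yy'; pose O := `]y, y'[%classic : set R.
have mO : measurable O by exact: measurable_itv.
have ay' : a <= y' by rewrite (le_trans ay)// ltW.
(* The support of the weight begins at 2 y' - a > y', so only paths ending above [y'] count, and
   these have to cross the band [O]. *)
have -> : (\int[P]_w (refl_weight mu y' a (Y t w))%:E =
    \int[P]_(w in Y t @^-1` `]y', +oo[%classic) (refl_weight mu y' a (Y t w))%:E)%E.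
  rewrite [RHS]integral_mkcond; apply: eq_integral => w _; rewrite patchE.
  case: ifPn => //; rewrite notin_setE /= in_itv/= andbT => /negP; rewrite -leNgt => Yy.
  rewrite /refl_weight indicE memNset ?mulr0//= in_itv/= andbT.
  move=> /le_trans/(_ Yy); rewrite mulr_natl mulr2n -addrA gerDl subr_le0.
  by rewrite leNgt (le_lt_trans ay yy').
apply: (@integral_eventually_le _ _ _ _ _ _ (fun n => grid_hit W mu t n.+1 O)) => //.
- by move=> w; rewrite lee_fin refl_weight_ge0.
- exact: mgt.
- by move=> n; exact: measurable_grid_hit.
- apply: filterS path_ae => w [cW _ _ _]; rewrite /= in_itv/= andbT => y'Y.
  (* A crossing at the midpoint of the band. The assumption [0 <= y] places the start 0 below it. *)
  have [s st Ys] : exists2 s, 0 <= s <= t & Y s w = (y + y') / 2.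
    have cY : {within `[0, t], continuous (fun s => Y s w)}.
      have : {within `[0, t], continuous (fun s => W s w)}.
        by apply: continuous_subspaceW cW; apply: subset_itvl.
      move=> /subspace_continuousP cW'; apply/subspace_continuousP => s st.
      rewrite /drifted_increment /increment.
      apply: cvgD; last first.
        apply: cvgM; first exact: cvg_cst.
        apply: cvgB; last exact: cvg_cst.
        exact: cvg_within.
      by apply: cvgB; [exact: cW'|exact: cvg_cst].
    have Y0 : Y 0 w = 0 by rewrite /drifted_increment /increment !subrr mulr0 addr0.
    have Yt : 0 <= Y t w by rewrite ltW// (le_lt_trans y0)// (lt_trans yy').
    have [|s] := IVT (ltW ht) cY (v := (y + y') / 2).
      rewrite Y0 (min_idPl Yt) (max_idPr Yt); apply/andP; split.
        by rewrite divr_ge0// addr_ge0// ltW// (le_lt_trans y0).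
      by rewrite ltW// (lt_trans _ y'Y)// midf_lt.
    by rewrite in_itv/= => st sE; exists s.
  apply: (path_grid_hit cW _ st); first exact: interval_open.
  by rewrite /O/= in_itv/= Ys !midf_lt.
- move=> n; apply: (@le_trans _ _ (\int[P]_(w in grid_hit W mu t n.+1 O) (\1_(`]-oo, a]%classic : set R) (Y t w))%:E)%E).
    by apply: grid_hit_below => // x; rewrite /O/= !in_itv/= => /andP[].
  rewrite integral_mkcond [leRHS]integral_mkcond; apply: ae_ge0_le_integral => //.
  + by move=> w _; rewrite patchE; case: ifPn => //; rewrite lee_fin.
  + by apply/(measurable_restrictT _ _).1; [exact: measurable_grid_hit|exact: measurable_funTS].
  + by move=> w _; rewrite patchE; case: ifPn => //; rewrite lee_fin.
  + by apply/(measurable_restrictT _ _).1; [exact: mgt|exact: measurable_funTS].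
  apply: filterS path_ae => w [_ _ YM _] _; rewrite !patchE; case: ifPn => [|_]; last first.
    by case: ifPn => //; rewrite lee_fin.
  rewrite inE => -[k kn]; rewrite /O /= in_itv/= => /andP[yY _].
  rewrite mem_set//= in_itv/= andbT (lt_le_trans yY)// YM//.
  by rewrite grid_ge0//= -[leRHS](gridN t (ltn0Sn n)) ler_grid.
Qed.

Lemma joint_above a y : 0 <= y -> a <= y ->
  P (drifted W mu t @^-1` `]-oo, a]%classic `&` M @^-1` `]y, +oo[%classic) =
  (expR (2 * mu * y) * Phi ((a - 2 * y - mu * t) / Num.sqrt t))%:E.
Proof.
move=> y0 ay.
set J := fun y => expR (2 * mu * y) * Phi ((a - 2 * y - mu * t) / Num.sqrt t).
have PE : P (drifted W mu t @^-1` `]-oo, a]%classic `&` M @^-1` `]y, +oo[%classic) =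
    (\int[P]_(w in M @^-1` `]y, +oo[%classic) (\1_(`]-oo, a]%classic : set R) (Y t w))%:E)%E.
  rewrite -(@integral_indic _ _ _ P _ (mgt y (measurable_funP M)) (drifted W mu t @^-1` `]-oo, a]%classic)); last first.
    by rewrite -[X in measurable X]setTI; exact: measurable_drifted.
  apply: ge0_ae_eq_integral => //.
  - exact: mgt.
  - apply/measurable_EFinP/measurable_funTS; apply: measurable_indic.
    by rewrite -[X in measurable X]setTI; exact: measurable_drifted.
  - exact: measurable_funTS.
  apply: filterS path_ae => w [_ _ _ E] _.
  by rewrite !indicE !mem_setE /= -E.
rewrite PE; apply/eqP; rewrite eq_le; apply/andP; split.
  by rewrite -integral_refl_weight_Y; exact: integral_max_above.
have cJ : continuous J.
  move=> z; apply: cvgM.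
    apply: continuous_comp; last exact: continuous_expR.
    by apply: cvgM; [exact: cvg_cst|exact: cvg_id].
  apply: (cvg_comp (fun x => (a - 2 * x - mu * t) / Num.sqrt t) Phi); last exact: continuous_Phi.
  apply: cvgM; last exact: cvg_cst.
  apply: cvgB; last exact: cvg_cst.
  apply: cvgB; first exact: cvg_cst.
  by apply: cvgM; [exact: cvg_cst|exact: cvg_id].
have JE y' : y < y' -> ((J y')%:E <= \int[P]_(w in M @^-1` `]y, +oo[%classic) (\1_(`]-oo, a]%classic : set R) (Y t w))%:E)%E.
  by move=> yy'; rewrite /J -integral_refl_weight_Y; exact: integral_max_below.
rewrite -/(J y).
have : J z @[z --> y^'+] --> J y by apply: cvg_at_right_filter; exact: cJ.
move=> cJy.
have fE : (\int[P]_(w in M @^-1` `]y, +oo[%classic) (\1_(`]-oo, a]%classic : set R) (Y t w))%:E \is a fin_num)%E.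
  by rewrite -PE fin_num_measure//; apply: measurableI; [rewrite -[X in measurable X]setTI; exact: measurable_drifted|exact: mgt].
rewrite -(fineK fE) lee_fin.
have -> : J y = lim (J z @[z --> y^'+]) by apply/esym/cvg_lim.
apply: limr_le; first by apply/cvg_ex; exists (J y).
near=> z; rewrite -lee_fin fineK//; apply: JE; near: z.
exact: nbhs_right_gt.
Unshelve. all: by end_near. Qed.

End joint_law.

(** * Distribution function and density of the maximum *)

Section max_density_facts.
Context {R : realType}.

Lemma is_derive_affine (a b x : R) : is_derive x 1 (fun x => a * x + b) a.
Proof.
have h := is_deriveD (is_deriveZ a (is_derive_id x (1 : R))) (is_derive_cst b x (1 : R)).
by apply: is_derive_eq h _; rewrite addr0 /GRing.scale/= mulr1.
Qed.

Lemma phiE (x : R) : phi x = normal_peak 1 * expR (- (x ^+ 2 / 2)).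
Proof. by rewrite /phi normal_pdf_exp// subr0 expr1n mulNr. Qed.

Lemma is_derive_phi (x : R) : is_derive x 1 phi (- x * phi x).
Proof.
have -> : @phi R = (fun x => normal_peak 1 *: expR (- 2^-1 * (x * x))).
  by apply/funext => z; rewrite phiE; congr (_ * expR _); field.
have d2 : is_derive x 1 (fun z : R => - 2^-1 * (z * z)) (- x).
  have h := is_deriveZ (- 2^-1) (is_deriveM (is_derive_id x (1 : R)) (is_derive_id x (1 : R))).
  apply: is_derive_eq h _; rewrite /GRing.scale/=.
  by field.
have d3 := @is_derive1_comp R expR (fun z => - 2^-1 * (z * z)) x _ _ (is_derive_expR (- 2^-1 * (x * x))) d2.
have d4 : is_derive x 1 (normal_peak 1 *: (expR \o (fun z : R => - 2^-1 * (z * z))))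
  (normal_peak 1 *: (expR (- 2^-1 * (x * x)) * - x)) by exact: is_deriveZ.
apply: is_derive_eq d4 _.
by rewrite /GRing.scale/=; ring.
Qed.

Lemma is_derive_Phi_affine (a b x : R) :
  is_derive x 1 (fun x => Phi (a * x + b)) (a * phi (a * x + b)).
Proof.
rewrite mulrC; apply: (@is_derive1_comp R Phi (fun x => a * x + b)).
  exact: is_derive_Phi.
exact: is_derive_affine.
Qed.

Lemma is_derive_expR_linear (a x : R) :
  is_derive x 1 (fun x => expR (a * x)) (a * expR (a * x)).
Proof.
have d : is_derive x 1 (fun x => a * x) a.
  have -> : (fun x => a * x) = (fun x => a * x + 0) by apply/funext => z; rewrite addr0.
  exact: is_derive_affine.
rewrite mulrC; exact: (@is_derive1_comp R expR (fun x => a * x) x _ a (is_derive_expR (a * x)) d).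
Qed.

Variables (mu t : R).
Hypothesis ht : 0 < t.
Local Notation st := (Num.sqrt t).

Let st0 : 0 < st. Proof. by rewrite sqrtr_gt0. Qed.

Let stt : st * st = t. Proof. by rewrite -expr2 sqr_sqrtr// ltW. Qed.

Definition max_cdf (y : R) : R :=
  Phi ((y - mu * t) / st) - expR (2 * mu * y) * Phi ((- y - mu * t) / st).

Lemma max_cdf0 : max_cdf 0 = 0.
Proof. by rewrite /max_cdf mulr0 expR0 mul1r oppr0 subrr. Qed.

Lemma is_derive_max_cdf (y : R) : is_derive y 1 max_cdf (max_density mu t y).
Proof.
have -> : max_cdf = (fun y => Phi (st^-1 * y + (- mu * t / st))) -
    (fun y => expR (2 * mu * y)) * (fun y => Phi (- st^-1 * y + (- mu * t / st))).
  apply/funext => z; rewrite /max_cdf !fctE; congr (Phi _ - _ * Phi _).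
    by field; rewrite gt_eqF.
  by field; rewrite gt_eqF.
have d1 := is_derive_Phi_affine st^-1 (- mu * t / st) y.
have d2 := is_derive_Phi_affine (- st^-1) (- mu * t / st) y.
have d3 := is_derive_expR_linear (2 * mu) y.
apply: is_derive_eq (is_deriveB d1 (is_deriveM d3 d2)) _.
rewrite /max_density /GRing.scale/=.
have -> : (y - mu * t) / st = st^-1 * y + - mu * t / st by field; rewrite gt_eqF.
have -> : (- y - mu * t) / st = - st^-1 * y + - mu * t / st by field; rewrite gt_eqF.
by ring.
Qed.

(** Makes the two terms in [phi] of the density of the maximum equal, so that a common factor e^{2
    mu y} can be taken out. *)
Lemma phi_reflect (y : R) :
  phi ((y - mu * t) / st) = expR (2 * mu * y) * phi ((- y - mu * t) / st).
Proof.
rewrite !phiE mulrCA; congr (_ * _); rewrite -expRD; congr expR.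
rewrite !expr_div_n sqr_sqrtr ?ltW//.
by field; rewrite gt_eqF.
Qed.

(* Up to a positive factor the density is the value at [z = (- y - mu t) / st]
   of [2 / st phi z - 2 mu Phi z], which vanishes at [-oo] and increases as
   long as [z < - mu st]. *)
Lemma max_density_gt0 (y : R) : 0 < y -> 0 < max_density mu t y.
Proof.
move=> y0.
pose k (z : R) : R := 2 / st * phi z - 2 * mu * Phi z.
pose z0 := (- y - mu * t) / st.
have -> : max_density mu t y = expR (2 * mu * y) * k z0.
  by rewrite /max_density phi_reflect /k -/z0; ring.
rewrite mulr_gt0 ?expR_gt0//.
have dk (z : R) : is_derive z 1 k (- (2 / st) * phi z * (z + mu * st)).
  have d := is_deriveB (is_deriveZ (2 / st) (is_derive_phi z)) (is_deriveZ (2 * mu) (is_derive_Phi z)).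
  apply: is_derive_eq d _; rewrite /GRing.scale/=.
  by field; rewrite gt_eqF.
have ck : continuous k by move=> z; apply: is_derive_continuous; exact: dk.
have kinc (z z' : R) : z < z' -> z' <= z0 -> k z < k z'.
  move=> zz' z'z0; apply: (gt0_is_derive_lt zz' ck (fun x _ => dk x)) => x xx.
  rewrite nmulr_rgt0; last first.
    by rewrite pmulr_llt0 ?phi_gt0// oppr_lt0 divr_gt0.
  apply: (@lt_le_trans _ _ (z0 + mu * st)).
    by rewrite ltrD2r (lt_le_trans _ z'z0)//; case/andP: xx.
  rewrite (_ : z0 + mu * st = - (y / st)) ?oppr_le0 ?divr_ge0 ?ltW//.
  have E : mu * t = mu * (st * st) by rewrite stt.
  by rewrite /z0 E; field; rewrite gt_eqF.
have z01 : z0 - 1 < z0 by rewrite ltrBlDr ltrDl.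
(* [eta] is the rise of [k] over the last unit interval. As [k] is at least - c Phi, which tends to
   0 at -oo, some z' < z0 - 1 has k z' > - eta, and then k z0 = k (z0 - 1) + eta > k z' + eta > 0.
   The 1 in [c] keeps it positive when [mu] is 0, and the minimum with [z0 - 2] puts [z'] to the
   left of [z0 - 1]. *)
have := kinc _ _ z01 (lexx _); rewrite -subr_gt0; set eta := k z0 - k (z0 - 1) => eta0.
pose c := 2 * `|mu| + 1.
have c0 : 0 < c by rewrite ltr_wpDl// mulr_ge0.
have /(cdf_lt (@Phi_cvgNy0 R))[z zE] : 0 < eta / c by rewrite divr_gt0.
pose z' := Num.min z (z0 - 2).
have kz' : - eta < k z'.
  have Pz' : Phi z' < eta / c.
    by apply: le_lt_trans zE; rewrite ler_PhiE ge_min lexx.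
  have : c * Phi z' < eta by rewrite mulrC -ltr_pdivlMr.
  rewrite ltrNl; apply: le_lt_trans; rewrite /k opprB lerBlDr.
  apply: (@le_trans _ _ (c * Phi z')).
    rewrite ler_wpM2r ?Phi_ge0// /c -[leLHS]addr0 lerD//.
    by rewrite ler_pM2l// ler_norm.
  by rewrite lerDl ltW// mulr_gt0 ?phi_gt0// divr_gt0.
have z'z : z' < z0 - 1 by rewrite gt_min ltrD2l ltrN2 ltr1n orbT.
have := kinc _ _ z'z (ltW z01) => /(lt_trans kz').
by rewrite /eta opprB ltrBlDr ltrDl.
Qed.

Lemma continuous_max_cdf : continuous max_cdf.
Proof. by move=> y; apply: is_derive_continuous; exact: is_derive_max_cdf. Qed.

Lemma max_cdf_lt (y y' : R) : 0 <= y -> y < y' -> max_cdf y < max_cdf y'.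
Proof.
move=> y0 yy'; apply: (gt0_is_derive_lt yy' continuous_max_cdf) => x /andP[yx _].
  exact: is_derive_max_cdf.
by rewrite max_density_gt0// (le_lt_trans y0).
Qed.

Lemma continuous_max_density : continuous (max_density mu t).
Proof.
have ca (a b : R) : continuous (fun y => a * y + b).
  by move=> y; apply: is_derive_continuous; exact: is_derive_affine.
have -> : max_density mu t = (fun y => st^-1 * phi (st^-1 * y + (- mu * t / st)) -
   expR (2 * mu * y) * (2 * mu * Phi (- st^-1 * y + (- mu * t / st)) - st^-1 * phi (- st^-1 * y + (- mu * t / st)))).
  apply/funext => y; rewrite /max_density.
  have -> : (y - mu * t) / st = st^-1 * y + - mu * t / st by field; rewrite gt_eqF.
  by have -> : (- y - mu * t) / st = - st^-1 * y + - mu * t / st by field; rewrite gt_eqF.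
move=> y; apply: cvgB.
  apply: cvgM; first exact: cvg_cst.
  by apply: (cvg_comp (fun y => st^-1 * y + _) phi); [exact: ca|exact: continuous_phi].
apply: cvgM.
  exact: (is_derive_continuous (is_derive_expR_linear (2 * mu) y)).
apply: cvgB; apply: cvgM; try exact: cvg_cst.
  by apply: (cvg_comp (fun y => - st^-1 * y + _) Phi); [exact: ca|exact: continuous_Phi].
by apply: (cvg_comp (fun y => - st^-1 * y + _) phi); [exact: ca|exact: continuous_phi].
Qed.

End max_density_facts.

Lemma ae_eq_measure d (T : measurableType d) (R : realType)
    (m : {measure set T -> \bar R}) (A B : set T) :
  measurable A -> measurable B -> {ae m, forall w, A w <-> B w} -> m A = m B.
Proof.
move=> mA mB AB.
have E C : measurable C -> m C = (\int[m]_w (\1_C w)%:E)%E.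
  by move=> mC; rewrite integral_indic// setIT.
rewrite !E//; apply: ge0_ae_eq_integral => //.
- exact/measurable_EFinP/measurable_indic.
- exact/measurable_EFinP/measurable_indic.
- apply: filterS AB => w ABw _; rewrite !indicE; congr (_%:R%:E); congr nat_of_bool.
  by apply/idP/idP; rewrite !inE; apply ABw.
Qed.

Section marginals.
Context (R : realType) d (T : measurableType d) (P : probability T R).
Variables (W : R -> {RV P >-> R}) (mu t : R) (M : {RV P >-> R}).
Hypotheses (ht : 0 < t) (hW : standard_brownian_motion W).
Hypothesis hM : running_max (drifted W mu) t M.
Local Notation X := (drifted W mu t : {RV P >-> R}).
Local Notation st := (Num.sqrt t).

Let st0 : 0 < st. Proof. by rewrite sqrtr_gt0. Qed.

Let mX (A : set R) : measurable A -> measurable (drifted W mu t @^-1` A).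
Proof. by move=> mA; rewrite -[X in measurable X]setTI; exact: measurable_drifted. Qed.

Let mM (A : set R) : measurable A -> measurable (M @^-1` A).
Proof. by move=> mA; rewrite -[X in measurable X]setTI; exact: measurable_funP. Qed.

Lemma drifted_law (A : set R) : measurable A ->
  P (drifted W mu t @^-1` A) = normal_prob (mu * t) st A.
Proof.
move=> mA; have := drifted_increment_law mu hW (lexx 0) ht mA.
rewrite subr0 sqr_sqrtr ?ltW// => <-.
apply: ae_eq_measure; first exact: mX.
  by rewrite -[X in measurable X]setTI; exact: measurable_drifted_increment.
by apply: filterS (path_ae hW hM) => w [_ _ _ E]; rewrite /= E.
Qed.

Lemma dist_fun_drifted (x : R) : dist_fun X x = Phi ((x - mu * t) / st).
Proof.
rewrite /dist_fun /cdf /distribution /pushforward drifted_law//.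
by rewrite normal_prob_Nyc.
Qed.

Lemma joint_below (x y : R) : 0 <= y -> x <= y ->
  P (drifted W mu t @^-1` `]-oo, x]%classic `&` M @^-1` `]-oo, y]%classic) =
  (Phi ((x - mu * t) / st) -
   expR (2 * mu * y) * Phi ((x - 2 * y - mu * t) / st))%:E.
Proof.
move=> y0 xy; have := joint_above ht hW hM y0 xy.
set A := drifted W mu t @^-1` _; set B := M @^-1` `]y, +oo[%classic => E.
have mA : measurable A by exact: mX.
have mB : measurable B by exact: mM.
have -> : M @^-1` `]-oo, y]%classic = ~` B.
  by rewrite predeqE => w; rewrite /B/= !in_itv/= andbT; split=> [|/negP]; rewrite -?leNgt// => h; apply/negP; rewrite -leNgt.
have D : P (A `\` B) = (P A - P (A `&` B))%E.
  by apply: measureD => //; rewrite ltey_eq fin_num_measure.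
rewrite -setDE D E EFinB; congr (_ - _)%E.
by rewrite /A drifted_law// normal_prob_Nyc.
Qed.

Lemma max_neg (x y : R) : y < 0 ->
  P (drifted W mu t @^-1` `]-oo, x]%classic `&` M @^-1` `]-oo, y]%classic) = 0%E.
Proof.
move=> y0; rewrite -(measure0 P); apply: ae_eq_measure => //.
  by apply: measurableI; [exact: mX|exact: mM].
apply: filterS (path_ae hW hM) => w [_ _ YM _]; split => // -[_] /=.
rewrite in_itv/= leNgt => /negP; apply; apply: (lt_le_trans y0).
have /YM : 0 <= (0 : R) <= t by rewrite lexx ltW.
by apply: le_trans; rewrite /drifted_increment /increment !subrr mulr0 addr0.
Qed.

(** The endpoint is almost surely at most the maximum; this reduces every [x] to the range [x <= y]
    of the reflection formula. *)
Lemma joint_max_le (x y : R) :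
  P (drifted W mu t @^-1` `]-oo, x]%classic `&` M @^-1` `]-oo, y]%classic) =
  P (drifted W mu t @^-1` `]-oo, Num.min x y]%classic `&` M @^-1` `]-oo, y]%classic).
Proof.
apply: ae_eq_measure.
- by apply: measurableI; [exact: mX|exact: mM].
- by apply: measurableI; [exact: mX|exact: mM].
apply: filterS (path_ae hW hM) => w [_ _ YM E] /=; rewrite !in_itv/= le_min E.
split=> [[-> My]|[/andP[-> _] ->]]//.
rewrite My; split => //=; apply: le_trans My; apply: YM.
by rewrite lexx ltW.
Qed.

Lemma max_law (y : R) : P (M @^-1` `]-oo, y]%classic) =
  P (drifted W mu t @^-1` `]-oo, y]%classic `&` M @^-1` `]-oo, y]%classic).
Proof.
apply: ae_eq_measure.
- exact: mM.
- by apply: measurableI; [exact: mX|exact: mM].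
apply: filterS (path_ae hW hM) => w [_ _ YM E] /=; rewrite !in_itv/= E.
split=> [My|[]//]; split => //; apply: le_trans My; apply: YM.
by rewrite lexx ltW.
Qed.

(** Since [max_cdf] vanishes at 0, truncating the argument covers negative levels too, and
    continuity becomes that of a composition. *)
Lemma dist_fun_max (y : R) : dist_fun M y = max_cdf mu t (Num.max y 0).
Proof.
rewrite /dist_fun /cdf /distribution /pushforward max_law.
have [y0|y0] := leP 0 y.
  rewrite (joint_below y0 (lexx y)) /= /max_cdf.
  by have -> : y - 2 * y - mu * t = - y - mu * t by ring.
by rewrite max_neg// max_cdf0.
Qed.

Lemma joint_dist_fun_max (x y : R) : 0 <= y ->
  joint_dist_fun X M x y = Phi ((Num.min x y - mu * t) / st) -
    expR (2 * mu * y) * Phi ((Num.min x y - 2 * y - mu * t) / st).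
Proof.
move=> y0; rewrite /joint_dist_fun joint_max_le joint_below//.
by rewrite ge_min lexx orbT.
Qed.

Lemma continuous_dist_fun_drifted : continuous (dist_fun X).
Proof.
have -> : dist_fun X = (fun x => Phi (st^-1 * x + (- (mu * t) / st))).
  by apply/funext => x; rewrite dist_fun_drifted mulrDl [_ / st]mulrC.
by move=> x; apply: (is_derive_continuous (is_derive_Phi_affine st^-1 (- (mu * t) / st) x)).
Qed.

Lemma continuous_dist_fun_max : continuous (dist_fun M).
Proof.
have -> : dist_fun M = (fun y => max_cdf mu t (Num.max y 0)).
  by apply/funext => y; exact: dist_fun_max.
move=> y; apply: (cvg_comp (fun y => Num.max y 0) (max_cdf mu t)); last exact: continuous_max_cdf.
exact: (@continuous_max R R idfun (cst 0) y cvg_id (cvg_cst _)).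
Qed.

End marginals.

(** * Uniform transforms and Sklar's theorem *)

Section dist_fun_facts.
Context (R : realType) d (T : measurableType d) (P : probability T R).
Variable X : {RV P >-> R}.

Lemma dist_fun_cvgy1 : dist_fun X x @[x --> +oo%R] --> (1 : R).
Proof. exact/fine_cvg/cvg_cdfy1. Qed.

Lemma dist_fun_cvgNy0 : dist_fun X x @[x --> -oo%R] --> (0 : R).
Proof. exact/fine_cvg/cvg_cdfNy0. Qed.

Lemma dist_fun_homo : {homo dist_fun X : x y / x <= y}.
Proof.
by move=> x y xy; rewrite /dist_fun fine_le ?fin_num_measure//; exact: cdf_nondecreasing.
Qed.

Lemma dist_funE x : (dist_fun X x)%:E = P (X @^-1` `]-oo, x]%classic).
Proof.
rewrite /dist_fun fineK//; apply: fin_num_measure.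
exact: measurable_itv.
Qed.

Lemma measurable_dist_fun : measurable_fun setT (dist_fun X).
Proof. exact: nondecreasing_measurable measurableT dist_fun_homo. Qed.

End dist_fun_facts.

Section lebesgue_on_R.
Context {R : realType}.
Local Notation leb := (@lebesgue_measure R).

Let idR : measurableTypeR R -> R := idfun.

Let measurable_idR : measurable_fun setT idR.
Proof. by move=> _ A mA; rewrite setTI; exact: mA. Qed.

(** Lebesgue measure moved to the measurable structure of [R] itself, where the laws of real random
    variables live. *)
Definition lebR : {measure set R -> \bar R} := image_measure leb measurable_idR.

Lemma ge0_integral_lebR (f : R -> \bar R) : measurable_fun setT f -> (forall x, 0 <= f x)%E ->
  (\int[lebR]_x f x = \int[leb]_x f x)%E.
Proof. by move=> mf f0; rewrite ge0_integral_image. Qed.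

Lemma ge0_integral_lebR_in (A : set R) (f : R -> \bar R) : measurable A ->
  measurable_fun setT f -> (forall x, 0 <= f x)%E ->
  (\int[lebR]_(x in A) f x = \int[leb]_(x in A) f x)%E.
Proof.
move=> mA mf f0; rewrite integral_mkcond [RHS]integral_mkcond; apply: ge0_integral_lebR.
  by apply/(measurable_restrictT _ _).1 => //; exact: measurable_funTS.
by move=> x; rewrite patchE; case: ifPn.
Qed.

Lemma integral_deriv (f F : R -> R) (a b : R) : a <= b -> continuous f ->
  (forall x : R, is_derive x 1 F (f x)) ->
  (\int[leb]_(x in `[a, b]) (f x)%:E = (F b - F a)%:E)%E.
Proof.
rewrite le_eqVlt => /predU1P[<-|ab] cf dF.
  by rewrite set_itv1 integral_set1 subrr.
rewrite (@continuous_FTC2 _ f F)//.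
- exact: continuous_subspaceT.
- split.
  + by move=> x _; have [] := dF x.
  + by apply: cvg_at_right_filter; exact: (is_derive_continuous (dF a)).
  + by apply: cvg_at_left_filter; exact: (is_derive_continuous (dF b)).
- by move=> x _; rewrite derive1E; have [_ ->] := dF x.
Qed.

End lebesgue_on_R.

Section uniform_transform.
Context (R : realType) d (T : measurableType d) (P : probability T R).
Variable X : {RV P >-> R}.
Hypothesis cX : continuous (dist_fun X).
Local Notation F := (dist_fun X).
Local Notation leb := (@lebesgue_measure R).

Let FX w := F (X w).

Lemma measurable_dist_fun_comp : measurable_fun setT (fun w => F (X w)).
Proof. by apply: measurableT_comp => //; exact: measurable_dist_fun. Qed.

Let mFX (A : set R) : measurable A -> measurable (FX @^-1` A).
Proof. by move=> mA; rewrite -[X in measurable X]setTI; exact: measurable_dist_fun_comp. Qed.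

Lemma dist_fun_le1 x : F x <= 1.
Proof. by rewrite -lee_fin dist_funE probability_le1//; rewrite -[X in measurable X]setTI; exact: measurable_funP. Qed.

Lemma dist_fun_ge0 x : 0 <= F x.
Proof. by rewrite -lee_fin dist_funE. Qed.

(** [F] may have flat pieces, so the event is squeezed: it contains [X <= x] when F x = u, and is
    contained in [X <= x] when F x > u. *)
Lemma dist_fun_comp_law u : 0 <= u <= 1 ->
  P (FX @^-1` `]-oo, u]%classic) = u%:E.
Proof.
move=> /andP[u0 u1].
have surj v : 0 < v < 1 -> exists x, F x = v.
  exact: (cdf_surj cX (@dist_fun_homo _ _ _ _ X) (@dist_fun_cvgNy0 _ _ _ _ X) (@dist_fun_cvgy1 _ _ _ _ X)).
have fin : P (FX @^-1` `]-oo, u]%classic) \is a fin_num by apply: fin_num_measure; exact: mFX.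
apply/eqP; rewrite eq_le; apply/andP; split.
  move: u1; rewrite (le_eqVlt u 1) => /predU1P[->|u1]; first by rewrite probability_le1//; exact: mFX.
  rewrite -(fineK fin) lee_fin; apply/ler_addgt0Pl => e e0.
  (* A value above [u], at most [u + e], and still below 1 so that [F] attains it. *)
  pose v := Num.min (u + e) ((u + 1) / 2).
  have uv : u < v by rewrite lt_min ltrDl e0 midf_lt.
  have v1 : v < 1 by rewrite gt_min midf_lt// orbT.
  have [|x xv] := surj v; first by rewrite (le_lt_trans u0).
  apply: (@le_trans _ _ v); last by rewrite ge_min addrC lexx.
  rewrite -lee_fin fineK// -xv dist_funE; apply: le_measure; rewrite ?inE.
  - exact: mFX.
  - by rewrite -[X in measurable X]setTI; exact: measurable_funP.
  - move=> w; rewrite /= !in_itv/= => FXu; rewrite leNgt; apply/negP => /ltW /(dist_fun_homo X).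
    by rewrite xv leNgt (le_lt_trans FXu uv).
move: u0; rewrite (le_eqVlt 0 u) => /predU1P[<-//|u0].
move: u1; rewrite (le_eqVlt u 1) => /predU1P[u1|u1].
  rewrite (_ : FX @^-1` _ = setT) ?probability_setT ?u1//.
  by rewrite -subTset => w _; rewrite /= in_itv/= dist_fun_le1.
have [|x xu] := surj u; first by rewrite u0.
rewrite -[in leLHS]xu dist_funE; apply: le_measure; rewrite ?inE.
- by rewrite -[X in measurable X]setTI; exact: measurable_funP.
- exact: mFX.
- by move=> w; rewrite /= !in_itv/= => /(dist_fun_homo X); rewrite xu.
Qed.

Let I (x : R) : R := \1_(`]0, 1[%classic : set R) x.

Let lebR_I (u : R) : (\int[@lebR R]_(x in `]-oo, u]%classic) (I x)%:E = (Num.max 0 (Num.min u 1))%:E)%E.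
Proof.
rewrite integral_indic//=.
have -> : lebR (`]0, 1[%classic `&` `]-oo, u]%classic) = leb (`]0, 1[%classic `&` `]-oo, u]%classic) by [].
have [u0|u0] := leP u 0.
  rewrite (_ : _ `&` _ = set0) ?measure0; last first.
    rewrite -subset0 => x /=; rewrite !in_itv/= => -[/andP[x0 _] xu].
    by move: (lt_le_trans x0 (le_trans xu u0)); rewrite ltxx.
  by rewrite (max_idPl _)// ge_min u0.
have [u1|u1] := leP 1 u.
  rewrite (_ : _ `&` _ = `]0, 1[%classic); last first.
    apply/setIidPl => x; rewrite /= !in_itv/= => /andP[_ x1].
    by rewrite (le_trans (ltW x1)).
  by rewrite lebesgue_measure_itv/= lte_fin ltr01 oppr0 adde0 (max_idPr _).
rewrite (_ : _ `&` _ = `]0, u]%classic); last first.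
  rewrite predeqE => x; rewrite /= !in_itv/=; split=> [[/andP[-> _] ->]//|/andP[-> xu]].
  by rewrite (le_lt_trans xu u1).
by rewrite lebesgue_measure_itv/= lte_fin u0 oppr0 adde0 (max_idPr (ltW u0)).
Qed.

Lemma dist_fun_comp_law_itv u :
  P (FX @^-1` `]-oo, u]%classic) = (Num.max 0 (Num.min u 1))%:E.
Proof.
have [u1|u1] := leP 1 u.
  rewrite (max_idPr ler01) (_ : FX @^-1` _ = setT) ?probability_setT//.
  by rewrite -subTset => w _; rewrite /= in_itv/= (le_trans (dist_fun_le1 _)).
have [u0|u0] := leP 0 u; first by rewrite dist_fun_comp_law// u0 ltW.
rewrite (_ : FX @^-1` _ = set0) ?measure0//.
rewrite -subset0 => w; rewrite /= in_itv/= => /le_lt_trans/(_ u0).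
by rewrite ltNge dist_fun_ge0.
Qed.

Lemma ge0_integral_dist_fun (p : R -> \bar R) : measurable_fun setT p -> (forall x, 0 <= p x)%E ->
  (\int[P]_w p (F (X w)) = \int[leb]_(v in `]0%R, 1%R[) p v)%E.
Proof.
move=> mp p0.
have mI : measurable_fun setT I by exact: measurable_indic.
have I0 x : 0 <= I x by [].
rewrite -(ge0_integral_image P measurable_dist_fun_comp)//.
rewrite (@ge0_integral_density _ _ _ lebR I mI I0)//.
  rewrite ge0_integral_lebR; last 2 first.
  - by apply: emeasurable_funM => //; exact/measurable_EFinP.
  - by move=> x; rewrite mule_ge0// lee_fin.
  rewrite [RHS]integral_mkcond; apply: eq_integral => x _.
  by rewrite patchE /I indicE; case: ifPn => _; rewrite ?mule1 ?mule0.
move=> A mA.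
rewrite -[RHS]/(density_measure lebR mI I0 A).
apply: finite_measure_cdf_unique mA => x.
  by rewrite (le_lt_trans (probability_le1 P _)) ?ltry//; exact: mFX.
transitivity (Num.max 0 (Num.min x 1))%:E; first exact: dist_fun_comp_law_itv.
exact/esym/lebR_I.
Qed.

End uniform_transform.

Section max_law_density.
Context (R : realType) d (T : measurableType d) (P : probability T R).
Variables (W : R -> {RV P >-> R}) (mu t : R) (M : {RV P >-> R}).
Hypotheses (ht : 0 < t) (hW : standard_brownian_motion W).
Hypothesis hM : running_max (drifted W mu) t M.
Local Notation leb := (@lebesgue_measure R).

(** Extension by 0 of the formula, whose sign is known only for positive [y]: [density_measure]
    requires a function nonnegative everywhere. *)
Definition max_density0 (y : R) : R := max_density mu t y * \1_(`]0, +oo[%classic : set R) y.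

Lemma measurable_max_density0 : measurable_fun setT max_density0.
Proof.
apply: measurable_funM; last exact: measurable_indic.
by apply: continuous_measurable_fun; exact: continuous_max_density.
Qed.

Lemma max_density0_ge0 y : 0 <= max_density0 y.
Proof.
rewrite /max_density0 indicE; have [y0|_] := boolP (y \in _); last by rewrite mulr0.
rewrite mulr1 ltW// max_density_gt0//.
by move: y0; rewrite mem_setE in_itv/= andbT.
Qed.

Lemma integral_max_density0 (A : set R) :
  (\int[leb]_(y in A) (max_density0 y)%:E = \int[leb]_(y in (`]0%R, +oo[%classic : set R) `&` A) (max_density mu t y)%:E)%E.
Proof.
rewrite setIC [RHS]integral_mkcondr; apply: eq_integral => y _.
by rewrite patchE /max_density0 indicE; case: ifPn => _; rewrite ?mulr1 ?mulr0.
Qed.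

Lemma max_law_density (A : set R) : measurable A ->
  distribution P M A = (\int[lebR]_(y in A) (max_density0 y)%:E)%E.
Proof.
move=> mA; rewrite -[RHS]/(density_measure lebR measurable_max_density0 max_density0_ge0 A).
apply: finite_measure_cdf_unique mA => y.
  by rewrite (le_lt_trans (probability_le1 _ _)) ?ltry.
rewrite -[LHS]dist_funE (dist_fun_max ht hW hM).
transitivity (\int[lebR]_(z in `]-oo, y]%classic) (max_density0 z)%:E)%E; last by [].
rewrite ge0_integral_lebR_in//; last 2 first.
- by apply/measurable_EFinP; exact: measurable_max_density0.
- by move=> x; rewrite lee_fin max_density0_ge0.
rewrite integral_max_density0.
have [y0|y0] := leP 0 y.
  rewrite (_ : _ `&` _ = `]0, y]%classic); last first.
    by rewrite predeqE => x; rewrite /= !in_itv/= andbT; split=> [[-> ->]|/andP[]].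
  rewrite integral_itv_obnd_cbnd; last first.
    apply/measurable_EFinP/measurable_funTS.
    by apply: continuous_measurable_fun; exact: continuous_max_density.
  rewrite (integral_deriv y0 (@continuous_max_density _ mu _ ht) (is_derive_max_cdf mu ht)).
  by rewrite max_cdf0 subr0.
rewrite max_cdf0 (_ : _ `&` _ = set0) ?integral_set0//.
rewrite -subset0 => x /=; rewrite !in_itv/= andbT => -[x0 xy].
by move: (lt_trans (lt_le_trans x0 xy) y0); rewrite ltxx.
Qed.

Lemma max_density_on : density_on leb (distribution P M) `]0, +oo[%classic (max_density mu t).
Proof.
split.
- exact: measurable_itv.
- apply: measurable_funTS; apply: (@continuous_measurable_fun R).
  exact: continuous_max_density.
- by move=> y /=; rewrite in_itv/= andbT => y0; rewrite ltW// max_density_gt0.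
move=> A mA; rewrite -integral_max_density0 -ge0_integral_lebR_in//; last 2 first.
- by apply/measurable_EFinP; exact: measurable_max_density0.
- by move=> x; rewrite lee_fin max_density0_ge0.
exact: max_law_density.
Qed.

End max_law_density.

Section sklar.
Context (R : realType) d (T : measurableType d) (P : probability T R).
Variables X Y : {RV P >-> R}.
Hypotheses (cX : continuous (dist_fun X)) (cY : continuous (dist_fun Y)).
Local Notation F := (dist_fun X).
Local Notation G := (dist_fun Y).

Let FG w := (F (X w), G (Y w)).

Let mFG : measurable_fun setT FG.
Proof. by apply: measurable_fun_pair; exact: measurable_dist_fun_comp. Qed.

HB.instance Definition _ := isMeasurableFun.Build _ _ _ _ FG mFG.

Definition copula_measure : probability (R * R)%type R := distribution P FG.

Lemma copula_measureE A : copula_measure A = P [set w | A (F (X w), G (Y w))].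
Proof. by []. Qed.

Let mX (A : set R) : measurable A -> measurable (X @^-1` A).
Proof. by move=> mA; rewrite -[X in measurable X]setTI; exact: measurable_funP. Qed.

Let mY (A : set R) : measurable A -> measurable (Y @^-1` A).
Proof. by move=> mA; rewrite -[X in measurable X]setTI; exact: measurable_funP. Qed.

(** The event [X <= x] lies in the event that [F (X w)] is at most [F x], and both have probability
    [F x]; they differ by a null set even where [F] is flat. *)
Lemma joint_copula_measure x y :
  P (X @^-1` `]-oo, x]%classic `&` Y @^-1` `]-oo, y]%classic) =
  copula_measure (`]-oo, F x]%classic `*` `]-oo, G y]%classic).
Proof.
have aeE (Z : {RV P >-> R}) (z : R) : continuous (dist_fun Z) ->
    {ae P, forall w, Z w <= z <-> dist_fun Z (Z w) <= dist_fun Z z}.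
  move=> cZ.
  have mA : measurable (Z @^-1` `]-oo, z]%classic).
    by rewrite -[X in measurable X]setTI; exact: measurable_funP.
  have mB : measurable ((fun w => dist_fun Z (Z w)) @^-1` `]-oo, dist_fun Z z]%classic).
    by rewrite -[X in measurable X]setTI; exact: measurable_dist_fun_comp.
  have PB := dist_fun_comp_law cZ (u := dist_fun Z z).
  rewrite dist_fun_ge0 dist_fun_le1 in PB.
  exists (((fun w => dist_fun Z (Z w)) @^-1` `]-oo, dist_fun Z z]%classic) `\` (Z @^-1` `]-oo, z]%classic)).
  split.
  - exact: measurableD.
  - have D := @measureD _ _ _ P _ _ mB mA.
    rewrite D; last by rewrite ltey_eq fin_num_measure.
    rewrite setIidr; last by move=> w; rewrite /= !in_itv/=; exact: dist_fun_homo.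
    apply: (@eq_trans _ _ ((dist_fun Z z)%:E - (dist_fun Z z)%:E)%E); last by rewrite subee.
    by congr (_ - _)%E; [exact: PB isT|exact/esym/dist_funE].
  - move=> w /= h; rewrite !in_itv/=; apply: contra_notP h => /not_andP[h|/contrapT h].
      by split => [/(dist_fun_homo Z)//|]; move: h => /[apply].
    by split=> // _; exact: dist_fun_homo.
rewrite copula_measureE; apply: ae_eq_measure.
- by apply: measurableI; [exact: mX|exact: mY].
- rewrite -[X in measurable X]setTI; apply: mFG => //.
  exact: measurableX.
- apply: filterS2 (aeE X x cX) (aeE Y y cY) => w hx hy /=.
  by rewrite !in_itv/=; split=> -[/hx ? /hy ?].
Qed.

Lemma dist_fun_comp_uniform (Z : {RV P >-> R}) (A : set R) : continuous (dist_fun Z) ->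
  measurable A -> P ((fun w => dist_fun Z (Z w)) @^-1` A) = uniform_prob (@ltr01 R) A.
Proof.
move=> cZ mA.
have mI : measurable_fun setT (fun x : R => (\1_A x : R)%:E).
  by apply/measurable_EFinP; exact: measurable_indic.
transitivity (\int[P]_w (\1_A (dist_fun Z (Z w)))%:E)%E.
  rewrite (_ : (fun w => _) = (fun w => (\1_((fun w => dist_fun Z (Z w)) @^-1` A) w : R)%:E))//.
  rewrite integral_indic// ?setIT//.
  by rewrite -[X in measurable X]setTI; exact: measurable_dist_fun_comp.
rewrite (ge0_integral_dist_fun cZ mI); last by move=> x; rewrite lee_fin.
transitivity (\int[uniform_prob (@ltr01 R)]_x (\1_A x)%:E)%E; last first.
  by rewrite integral_indic// setIT.
rewrite integral_uniform//.
rewrite subr0 invr1 mul1e.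
rewrite -(@integral_itv_bndoo _ 0 1 (fun x => (\1_A x)%:E) true false)//.
exact: measurable_funTS.
Qed.

Lemma copula_measure_margins : uniform_margins copula_measure.
Proof.
move=> A mA; split.
  rewrite copula_measureE -(dist_fun_comp_uniform cX mA); congr (P _).
  by rewrite predeqE => w; split => [[]|].
rewrite copula_measureE -(dist_fun_comp_uniform cY mA); congr (P _).
by rewrite predeqE => w; split => [[]|].
Qed.

Lemma copula_of_exists : exists C : R -> R -> R, copula_of X Y C.
Proof.
exists (fun u v => fine (copula_measure (`]-oo, u]%classic `*` `]-oo, v]%classic))); split => //.
  exists copula_measure; split; first exact: copula_measure_margins.
  move=> u v _ _; rewrite fineK// fin_num_measure//; exact: measurableX.
by move=> x y; rewrite /joint_dist_fun joint_copula_measure.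
Qed.

Let margin_low (Q : probability (R * R)%type R) (u v : R) : uniform_margins Q ->
  u <= 0 \/ v <= 0 -> Q (`]-oo, u]%classic `*` `]-oo, v]%classic) = 0%E.
Proof.
have unif0 (r : R) : r <= 0 -> uniform_prob (@ltr01 R) `]-oo, r]%classic = 0%E.
  move=> r0; rewrite -(dist_fun_comp_uniform cX)// dist_fun_comp_law_itv//.
  by rewrite (max_idPl _)// ge_min r0.
move=> mQ uv; apply/eqP; rewrite -measure_le0; case: uv => r0.
  rewrite -(unif0 _ r0) -(mQ _ (measurable_itv _)).1; apply: le_measure; rewrite ?inE.
  - exact: measurableX.
  - exact: measurableX.
  - by move=> z [].
rewrite -(unif0 _ r0) -(mQ _ (measurable_itv _)).2; apply: le_measure; rewrite ?inE.
- exact: measurableX.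
- exact: measurableX.
- by move=> z [].
Qed.

Let unif1 (r : R) : 1 <= r -> uniform_prob (@ltr01 R) `]r, +oo[%classic = 0%E.
Proof.
move=> r1; rewrite -(dist_fun_comp_uniform cX)//.
rewrite (_ : _ @^-1` _ = set0) ?measure0//.
rewrite -subset0 => w; rewrite /= in_itv/= andbT => /(le_lt_trans r1).
by rewrite ltNge dist_fun_le1.
Qed.

Let margin_highl (Q : probability (R * R)%type R) (u : R) (B : set R) : uniform_margins Q ->
  measurable B -> 1 <= u -> Q (`]-oo, u]%classic `*` B) = Q (setT `*` B).
Proof.
move=> mQ mB u1; apply/eqP; rewrite eq_le; apply/andP; split.
  by apply: le_measure; rewrite ?inE; [exact: measurableX|exact: measurableX|move=> z []].
rewrite -[leRHS]adde0 -(unif1 u1) -(mQ _ (measurable_itv _)).1.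
(* The missing mass has first coordinate above [u >= 1], which the uniform margin makes null. *)
apply: (@le_trans _ _ (Q ((`]-oo, u]%classic `*` B) `|` (`]u, +oo[%classic `*` setT)))).
  apply: le_measure; rewrite ?inE; [exact: measurableX|apply: measurableU; exact: measurableX|].
  move=> z [_ Bz]; have [zu|uz] := leP z.1 u; [left|right]; split => //=.
  by rewrite in_itv/= uz.
by apply: measureU2; exact: measurableX.
Qed.

Let margin_highr (Q : probability (R * R)%type R) (v : R) (B : set R) : uniform_margins Q ->
  measurable B -> 1 <= v -> Q (B `*` `]-oo, v]%classic) = Q (B `*` setT).
Proof.
move=> mQ mB v1; apply/eqP; rewrite eq_le; apply/andP; split.
  by apply: le_measure; rewrite ?inE; [exact: measurableX|exact: measurableX|move=> z []].
rewrite -[leRHS]adde0 -(unif1 v1) -(mQ _ (measurable_itv _)).2.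
apply: (@le_trans _ _ (Q ((B `*` `]-oo, v]%classic) `|` (setT `*` `]v, +oo[%classic)))).
  apply: le_measure; rewrite ?inE; [exact: measurableX|apply: measurableU; exact: measurableX|].
  move=> z [Bz _]; have [zu|uz] := leP z.2 v; [left|right]; split => //=.
  by rewrite in_itv/= uz.
by apply: measureU2; exact: measurableX.
Qed.

Let surj (Z : {RV P >-> R}) (v : R) : continuous (dist_fun Z) -> 0 < v < 1 ->
  exists x, dist_fun Z x = v.
Proof.
move=> cZ; exact: (cdf_surj cZ (@dist_fun_homo _ _ _ _ Z) (@dist_fun_cvgNy0 _ _ _ _ Z) (@dist_fun_cvgy1 _ _ _ _ Z)).
Qed.

(** A copula law is prescribed only at corners in the closed unit square; outside the open square
    the margins decide. Inside, continuity makes [u] and [v] values of [F] and [G], so the joint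
    distribution function determines [Q]. *)
Lemma copula_of_unique (C : R -> R -> R) (Q : probability (R * R)%type R) :
  copula_of X Y C -> copula_law C Q ->
  forall A, measurable A -> Q A = copula_measure A.
Proof.
move=> [_ _ _ CE] [mQ QE].
have mQ' := copula_measure_margins.
apply: finite_measure_joint_cdf_unique.
  by rewrite (le_lt_trans (probability_le1 Q _)) ?ltry.
move=> u v.
have [u0|u0] := leP u 0.
  by apply: etrans (margin_low mQ _) (esym (margin_low mQ' _)); left.
have [v0|v0] := leP v 0.
  by apply: etrans (margin_low mQ _) (esym (margin_low mQ' _)); right.
have [u1|u1] := leP 1 u.
  have E Q'' (mQ'' : uniform_margins Q'') : Q'' (`]-oo, u]%classic `*` `]-oo, v]%classic) =
      uniform_prob (@ltr01 R) `]-oo, v]%classic.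
    exact: etrans (margin_highl mQ'' (measurable_itv _) u1) (mQ'' _ (measurable_itv _)).2.
  exact: etrans (E _ mQ) (esym (E _ mQ')).
have [v1|v1] := leP 1 v.
  have E Q'' (mQ'' : uniform_margins Q'') : Q'' (`]-oo, u]%classic `*` `]-oo, v]%classic) =
      uniform_prob (@ltr01 R) `]-oo, u]%classic.
    exact: etrans (margin_highr mQ'' (measurable_itv _) v1) (mQ'' _ (measurable_itv _)).1.
  exact: etrans (E _ mQ) (esym (E _ mQ')).
apply: (@eq_trans _ _ (C u v)%:E); first by rewrite QE ?ltW ?u0 ?v0.
have [|x xu] := surj (v := u) cX; first by rewrite u0.
have [|y yv] := surj (v := v) cY; first by rewrite v0.
rewrite -xu -yv -CE /joint_dist_fun fineK ?joint_copula_measure//.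
by rewrite fin_num_measure//; exact: measurableX.
Qed.

End sklar.

Section uniform_transform2.
Context (R : realType) d (T : measurableType d) (P : probability T R).
Variables X Y : {RV P >-> R}.
Hypotheses (cX : continuous (dist_fun X)) (cY : continuous (dist_fun Y)).
Local Notation leb := (@lebesgue_measure R).
Local Notation B := (measurableTypeR R).
Local Notation I01 := (`]0, 1[%classic : set B).

Let ge0_integral_distribution_dist_fun (Z : {RV P >-> R}) (p : R -> \bar R) :
  continuous (dist_fun Z) -> measurable_fun setT p -> (forall x, 0 <= p x)%E ->
  (\int[distribution P Z]_x p (dist_fun Z x) = \int[leb]_(v in `]0%R, 1%R[) p v)%E.
Proof.
move=> cZ mp p0; rewrite -(ge0_integral_dist_fun cZ mp p0).
rewrite ge0_integral_distribution//.
by apply: measurableT_comp => //; exact: measurable_dist_fun.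
Qed.

Lemma ge0_integral_dist_fun2 (p : B * B -> \bar R) :
  measurable_fun setT p -> (forall z, 0 <= p z)%E ->
  (\int[distribution P X \x distribution P Y]_z p (dist_fun X z.1, dist_fun Y z.2) =
   \int[leb \x leb]_(z in I01 `*` I01) p z)%E.
Proof.
move=> mp p0.
have mI : measurable I01 by exact: measurable_itv.
pose p1 : B * B -> \bar R := p \_ (setT `*` I01).
pose p2 : B * B -> \bar R := p \_ (I01 `*` I01).
have mp1 : measurable_fun setT p1.
  apply/(measurable_restrictT _ _).1; first exact: measurableX.
  exact: measurable_funTS.
have mp2 : measurable_fun setT p2.
  apply/(measurable_restrictT _ _).1; first exact: measurableX.
  exact: measurable_funTS.
have p10 z : (0 <= p1 z)%E by rewrite /p1 patchE; case: ifPn.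
have p20 z : (0 <= p2 z)%E by rewrite /p2 patchE; case: ifPn.
have mpR : measurable_fun setT (p : R * R -> \bar R) by exact: mp.
rewrite (fubini_tonelli1 (m1 := distribution P X) (m2 := distribution P Y)); last 2 first.
- apply: (measurableT_comp mpR); apply: measurable_fun_pair.
    by apply: measurableT_comp; [exact: measurable_dist_fun|exact: measurable_fst].
  by apply: measurableT_comp; [exact: measurable_dist_fun|exact: measurable_snd].
- by move=> z; exact: p0.
rewrite [RHS]integral_mkcond -/p2 (fubini_tonelli1 (m1 := leb) (m2 := leb))//.
(* Cutting [p] off in the second variable turns its integral over the unit interval into one over
   the line, so that measurability in [x] comes from Tonelli's theorem. *)
pose q (x : R) : \bar R := fubini_F leb p1 x.
have qE (x : R) : q x = (\int[leb]_(v in `]0%R, 1%R[) p (x, v))%E.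
  rewrite /q /fubini_F [RHS]integral_mkcond; apply: eq_integral => y _.
  by rewrite /p1 !patchE in_setX/= in_setT.
have mq : measurable_fun setT q.
  exact: (measurable_fun_fubini_tonelli_F (m2 := leb) p1 mp1 p10).
have q0 x : (0 <= q x)%E by apply: integral_ge0 => y _; exact: p10.
transitivity (\int[distribution P X]_x q (dist_fun X x))%E.
  apply: eq_integral => x _; rewrite qE /fubini_F /=.
  apply: (ge0_integral_distribution_dist_fun (p := fun y => p (dist_fun X x, y)) cY).
  - by apply: (measurableT_comp mpR).
  - by move=> y; exact: p0.
rewrite (ge0_integral_distribution_dist_fun cX mq q0) integral_mkcond.
apply: eq_integral => x _; rewrite patchE /q /fubini_F; case: ifPn => x01.
  by apply: eq_integral => y _; rewrite /p1 /p2 !patchE !in_setX/= in_setT x01.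
by rewrite [RHS]integral0_eq// => y _; rewrite /p2 patchE in_setX/= (negbTE x01).
Qed.

End uniform_transform2.

(** * The copula and its density *)

Section copula_formula.
Context (R : realType) d (T : measurableType d) (P : probability T R).
Variables (W : R -> {RV P >-> R}) (mu t : R) (M : {RV P >-> R}).
Hypotheses (ht : 0 < t) (hW : standard_brownian_motion W).
Hypothesis hM : running_max (drifted W mu) t M.
Local Notation X := (drifted W mu t : {RV P >-> R}).
Local Notation st := (Num.sqrt t).
Local Notation F := (dist_fun X).
Local Notation G := (dist_fun M).
Local Notation zeta := (quantile (dist_fun M)).
Local Notation leb := (@lebesgue_measure R).

Let st0 : 0 < st. Proof. by rewrite sqrtr_gt0. Qed.

Let stt : st * st = t. Proof. by rewrite -expr2 sqr_sqrtr// ltW. Qed.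

Let cF : continuous F. Proof. exact: continuous_dist_fun_drifted ht hW hM. Qed.

Let cG : continuous G. Proof. exact: continuous_dist_fun_max ht hW hM. Qed.

Let FE (x : R) : F x = Phi ((x - mu * t) / st). Proof. exact: dist_fun_drifted ht hW hM x. Qed.

Let GE (y : R) : G y = max_cdf mu t (Num.max y 0). Proof. exact: dist_fun_max ht hW hM y. Qed.

Let Gpos (y : R) : 0 < y -> 0 < G y < 1.
Proof.
move=> y0; rewrite !GE (max_idPl (ltW y0)).
have G1 : max_cdf mu t y < max_cdf mu t (y + 1) by rewrite max_cdf_lt ?ltW ?ltrDl.
apply/andP; split; first by rewrite -(max_cdf0 mu t) max_cdf_lt.
apply: (lt_le_trans G1); have := dist_fun_le1 M (y + 1).
by rewrite GE (max_idPl _)// addr_ge0// ltW.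
Qed.

Let Gneg (y : R) : y <= 0 -> G y = 0.
Proof. by move=> y0; rewrite GE (max_idPr y0) max_cdf0. Qed.

Let GK (v : R) : 0 < v < 1 -> G (zeta v) = v.
Proof.
exact: (quantileK cG (@dist_fun_homo _ _ _ _ M) (@dist_fun_cvgNy0 _ _ _ _ M) (@dist_fun_cvgy1 _ _ _ _ M)).
Qed.

Let zeta_gt0 (v : R) : 0 < v < 1 -> 0 < zeta v.
Proof.
move=> v01; rewrite ltNge; apply/negP => /Gneg; rewrite GK// => v0.
by move: v01; rewrite v0 ltxx.
Qed.

Let zetaK (y : R) : 0 < y -> zeta (G y) = y.
Proof.
move=> y0; apply: (quantile_cdf cG (@dist_fun_homo _ _ _ _ M) (@dist_fun_cvgNy0 _ _ _ _ M) (@dist_fun_cvgy1 _ _ _ _ M)).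
  exact: Gpos.
move=> z zy; have [z0|z0] := leP z 0; first by rewrite Gneg//; case/andP: (Gpos y0).
by rewrite !GE !(max_idPl _) ?ltW// max_cdf_lt// ltW.
Qed.

Lemma copula_formula (C : R -> R -> R) (u v : R) : copula_of X M C ->
  0 < u < 1 -> 0 < v < 1 -> C u v = BM_max_copula mu t zeta u v.
Proof.
move=> [_ _ _ CE] u01 v01.
(* The point where [F] takes the value [u]; after standardisation the case condition of the formula
   reads [x <= y]. *)
pose x := st * quantile Phi u + mu * t; pose y := zeta v.
have y0 : 0 < y by exact: zeta_gt0.
have xq : (x - mu * t) / st = quantile Phi u.
  by rewrite /x; field; rewrite gt_eqF.
have Fx : F x = u by rewrite FE xq quantile_PhiK.
have Gy : G y = v by exact: GK.
rewrite -[in LHS]Fx -[in LHS]Gy -CE (joint_dist_fun_max ht hW hM)// ?(ltW y0)//.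
have cond : (u <= Phi ((y - mu * t) / st)) = (x <= y).
  rewrite -[in LHS](quantile_PhiK u01) ler_PhiE -xq.
  by rewrite ler_pM2r ?invr_gt0// lerD2r.
rewrite /BM_max_copula -/y cond; case: ifPn => [xy|].
  rewrite (min_idPl xy) xq quantile_PhiK//.
  have -> // : (x - 2 * y - mu * t) / st = quantile Phi u - 2 * y / st.
  by rewrite -xq; field; rewrite gt_eqF.
rewrite -ltNge => yx; rewrite (min_idPr (ltW yx)) -Gy GE (max_idPl (ltW y0)) /max_cdf.
by have -> : y - 2 * y - mu * t = - y - mu * t by ring.
Qed.

Local Notation c := (BM_max_copula_density mu t zeta).

(* The density of the maximum of a Brownian bridge from 0 to z, which is the
   joint density of (X, M) divided by the density of X. *)
Let g (z y : R) : R := 2 / t * (2 * y - z) * expR (2 * y * (z - y) / t).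

Let density_cond (z y : R) : 0 < y -> (F z <= Phi ((zeta (G y) - mu * t) / st)) = (z <= y).
Proof.
by move=> y0; rewrite zetaK// FE ler_PhiE ler_pM2r ?invr_gt0// lerD2r.
Qed.

Let density_transform (z y : R) : 0 < y ->
  c (F z) (G y) * max_density mu t y = if z <= y then g z y else 0.
Proof.
move=> y0; rewrite /BM_max_copula_density density_cond//.
case: ifPn => [zy|]; last by rewrite mul0r.
rewrite zetaK// FE quantile_Phi.
set w := (z - mu * t) / st.
have fy : max_density mu t y != 0 by rewrite gt_eqF// max_density_gt0.
have pw : phi w != 0 by rewrite gt_eqF// phi_gt0.
(* Writing [t] as the square of an atom lets [field] see the relation between [t] and its root. *)
have t2 : exists2 r, r = st & (r != 0) /\ t = r * r.
  by exists st => //; split; [rewrite gt_eqF|rewrite stt].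
have -> : phi (w - 2 * y / st) = phi w * expR (2 * y * w / st - 2 * y ^+ 2 / t).
  rewrite !phiE -[RHS]mulrA -expRD; congr (_ * expR _).
  by case: t2 => r <- [r0 ->]; field.
have -> : g z y = 2 * expR (2 * mu * y) * expR (2 * y * w / st - 2 * y ^+ 2 / t) *
    (st^-1 * (2 * y / st - w) - mu).
  rewrite /g -[2 * expR _ * _]mulrA -expRD.
  have -> : 2 * mu * y + (2 * y * w / st - 2 * y ^+ 2 / t) = 2 * y * (z - y) / t.
    by rewrite /w; case: t2 => r <- [r0 ->]; field.
  have -> : st^-1 * (2 * y / st - w) - mu = (2 * y - z) / t.
    by rewrite /w; case: t2 => r <- [r0 ->]; field.
  by ring.
by field; rewrite ?fy ?pw ?gt_eqF.
Qed.

(** The transformed density read back on the open square, in the form from which sign and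
    measurability are visible. *)
Let density_quantile (u v : R) : 0 < u < 1 -> 0 < v < 1 ->
  c u v = (if st * quantile Phi u + mu * t <= zeta v
           then g (st * quantile Phi u + mu * t) (zeta v) else 0) *
    (max_density mu t (zeta v))^-1.
Proof.
move=> u01 v01; have y0 := zeta_gt0 v01.
have fy : max_density mu t (zeta v) != 0 by rewrite gt_eqF// max_density_gt0.
rewrite -density_transform// mulfK// GK// FE.
rewrite addrK [st * _]mulrC mulfK ?gt_eqF// quantile_PhiK//.
Qed.

Let g_ge0 (z y : R) : 0 < y -> z <= y -> 0 <= g z y.
Proof.
move=> y0 zy; rewrite /g mulr_ge0 ?expR_ge0// mulr_ge0 ?divr_ge0 ?ltW//.
by rewrite subr_gt0 (le_lt_trans zy)// mulr_natl mulr2n ltrDl.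
Qed.

Lemma copula_density_ge0 (u v : R) : 0 < u < 1 -> 0 < v < 1 -> 0 <= c u v.
Proof.
move=> u01 v01; have y0 := zeta_gt0 v01; rewrite density_quantile//.
rewrite mulr_ge0//; last by rewrite invr_ge0 ltW// max_density_gt0.
by case: ifPn => // uv; exact: g_ge0.
Qed.

Let D : set (R * R) := `]0, 1[%classic `*` `]0, 1[%classic.

Let mD : measurable D. Proof. exact: measurableX. Qed.

Let mI01 : measurable (`]0, 1[%classic : set R). Proof. exact: measurable_itv. Qed.

Lemma measurable_copula_density : measurable_fun D (fun z => c z.1 z.2).
Proof.
pose q (z : R * R) := st * quantile Phi z.1 + mu * t.
have mq : measurable_fun D q.
  apply: measurable_funD => //; apply: measurable_funM => //.
  apply: (measurable_comp mI01 (g := fst)) => //.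
  - by move=> _ [z [z1 _] <-].
  - exact: (measurable_quantile (@continuous_Phi R) (@Phi_homo R) (@Phi_cvgNy0 R) (@Phi_cvgy1 R)).
  - by apply: measurable_funTS; exact: measurable_fst.
have mz : measurable_fun D (fun z => zeta z.2).
  apply: (measurable_comp mI01 (g := snd)) => //.
  - by move=> _ [z [_ z2] <-].
  - exact: (measurable_quantile cG (@dist_fun_homo _ _ _ _ M) (@dist_fun_cvgNy0 _ _ _ _ M) (@dist_fun_cvgy1 _ _ _ _ M)).
  - by apply: measurable_funTS; exact: measurable_snd.
have mfi : measurable_fun (`]0, +oo[%classic : set R) (fun y => (max_density mu t y)^-1).
  apply: open_continuous_measurable_fun; first exact: interval_open.
  move=> y; rewrite inE/= in_itv/= andbT => y0.
  apply: cvgV; first by rewrite gt_eqF// max_density_gt0.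
  exact: continuous_max_density.
apply: (@eq_measurable_fun _ _ _ _ _ (fun z => (if q z <= zeta z.2 then g (q z) (zeta z.2) else 0) * (max_density mu t (zeta z.2))^-1)).
  move=> z; rewrite inE => -[/=]; rewrite !in_itv/= => z1 z2.
  by rewrite density_quantile.
apply: measurable_funM; last first.
  apply: (measurable_comp (f := fun y => (max_density mu t y)^-1) (F := `]0, +oo[%classic : set R)) => //.
  move=> _ [z [_ z2] <-]; rewrite /= in_itv/= andbT; apply: zeta_gt0.
  by move: z2; rewrite /= in_itv.
pose k (z : R * R) := if z.1 <= z.2 then g z.1 z.2 else 0.
have mk : measurable_fun setT k.
  have m1 : measurable_fun setT (fst : R * R -> R) by exact: measurable_fst.
  have m2 : measurable_fun setT (snd : R * R -> R) by exact: measurable_snd.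
  apply: measurable_fun_ifT => //; first exact: measurable_fun_ler.
  apply: measurable_funM.
    apply: measurable_funM => //; apply: measurable_funB => //.
    exact: measurable_funM.
  apply: measurableT_comp => //; apply: measurable_funM => //.
  apply: measurable_funM; first exact: measurable_funM.
  exact: measurable_funB.
(* The quantiles are known to be measurable only on the open square; extending them by 0 allows
   composition with [k], which is measurable on the whole plane. *)
pose qD := q \_ D; pose zD := (fun z => zeta z.2) \_ D.
have mqD : measurable_fun setT qD by apply/(measurable_restrictT _ _).1.
have mzD : measurable_fun setT zD by apply/(measurable_restrictT _ _).1.
apply: (@eq_measurable_fun _ _ _ _ _ (fun z => k (qD z, zD z))).
  by move=> z zD'; rewrite /k /qD /zD !patchE zD'.
apply: measurable_funTS; apply: (measurableT_comp (f := k) (g := fun z => (qD z, zD z)) mk).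
exact: measurable_fun_pair.
Qed.

Let h (z : R * R) : R := ((fun z => c z.1 z.2) \_ D) z.

Let mh : measurable_fun setT h.
Proof. by apply/(measurable_restrictT _ _).1 => //; exact: measurable_copula_density. Qed.

Let h_ge0 z : 0 <= h z.
Proof.
rewrite /h patchE; case: ifPn => //; rewrite inE => -[/=]; rewrite !in_itv/= => z1 z2.
exact: copula_density_ge0.
Qed.

Let h_cdf (x y : R) : h (F x, G y) * max_density0 mu t y =
  if (0 < y) && (x <= y) then g x y else 0.
Proof.
rewrite /max_density0 indicE mem_setE in_itv/= andbT; have [y0|y0] /= := ltP 0 y; last by rewrite mulr0n !mulr0.
rewrite mulr1n mulr1 /h patchE mem_set; first by rewrite density_transform.
by split; rewrite /= in_itv/= ?FE ?Phi_gt0 ?Phi_lt1// Gpos.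
Qed.

Let FG (z : R * R) := (F z.1, G z.2).

Let mFG : measurable_fun setT FG.
Proof.
apply: measurable_fun_pair.
  by apply: (measurableT_comp (f := F)); [exact: measurable_dist_fun|exact: measurable_fst].
by apply: (measurableT_comp (f := G)); [exact: measurable_dist_fun|exact: measurable_snd].
Qed.

Let mhFG : measurable_fun setT (fun z => h (FG z)).
Proof. exact: measurableT_comp mh mFG. Qed.

Let hFG_ge0 z : 0 <= h (FG z). Proof. exact: h_ge0. Qed.

(** For [y] at least [x] and 0, minus the probability that the bridge from 0 to [x] over time [t]
    exceeds [y]. *)
Let E (x y : R) : R := - expR (2 * y * (x - y) / t).

Let is_derive_E (x y : R) : is_derive y 1 (E x) (g x y).
Proof.
pose e (y : R) : R := 2 / t * y * (- 1 * y + x).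
have de : is_derive y 1 e (2 / t * (x - 2 * y)).
  have d0 := is_deriveM (is_derive_affine (2 / t) 0 y) (is_derive_affine (- 1) x y).
  have -> : e = (fun x0 : R => 2 / t * x0 + 0) * (fun x0 : R => - 1 * x0 + x).
    by apply/funext => z; rewrite /e !fctE addr0.
  by apply: is_derive_eq d0 _; rewrite /GRing.scale/=; ring.
have d1 := @is_derive1_comp R expR e y _ _ (is_derive_expR (e y)) de.
have -> : E x = - (expR \o e).
  by apply/funext => z; rewrite /E /e !fctE; congr (- expR _); ring.
apply: is_derive_eq (is_deriveN d1) _.
rewrite /g; have -> : 2 * y * (x - y) / t = e y by rewrite /e; ring.
by ring.
Qed.

Let continuous_g (x : R) : continuous (g x).
Proof.
move=> y; apply: cvgM.
  apply: cvgM; first exact: cvg_cst.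
  apply: cvgB; last exact: cvg_cst.
  by apply: cvgM; [exact: cvg_cst|exact: cvg_id].
have -> : (fun y => expR (2 * y * (x - y) / t)) = - E x by apply/funext => z; rewrite /E fctE opprK.
have cE := is_derive_continuous (is_deriveN (is_derive_E x y)).
rewrite (_ : expR _ = (- E x) y); first exact: cE.
by rewrite fctE /E opprK.
Qed.

(** The right-hand side is the probability that the bridge ending at [x] stays below [y0]. *)
Let inner_integral (x y0 : R) : 0 < y0 ->
  (\int[distribution P M]_y (h (F x, G y) * \1_(`]-oo, y0]%classic : set R) y)%:E =
   (\1_(`]-oo, y0]%classic : set R) x - bridge_weight st y0 y0 x)%:E)%E.
Proof.
move=> y00.
have mf : measurable_fun setT (fun y => h (F x, G y) * \1_(`]-oo, y0]%classic : set R) y).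
  apply: measurable_funM; last exact: measurable_indic.
  apply: (measurableT_comp (f := h) (g := fun y => (F x, G y)) mh).
  by apply: measurable_fun_pair => //; exact: measurable_dist_fun.
rewrite (ge0_integral_density (m := lebR) (measurable_max_density0 mu ht) (max_density0_ge0 mu ht)); last 3 first.
- exact: max_law_density ht hW hM.
- exact/measurable_EFinP.
- by move=> y; rewrite lee_fin mulr_ge0.
rewrite ge0_integral_lebR; last 2 first.
- by apply: emeasurable_funM; apply/measurable_EFinP => //; exact: measurable_max_density0.
- by move=> y; rewrite mule_ge0// lee_fin ?max_density0_ge0// mulr_ge0.
transitivity (\int[leb]_y (if [&& 0 < y, x <= y & y <= y0] then g x y else 0)%:E)%E.
  apply: eq_integral => y _; rewrite -EFinM mulrAC h_cdf indicE mem_setE in_itv/=.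
  congr EFin; case: (0 < y) => /=; last by rewrite mul0r.
  case: (x <= y) => /=; last by rewrite mul0r.
  by case: (y <= y0); rewrite ?mulr1 ?mulr0.
have [xy0|y0x] := leP x y0; last first.
  rewrite integral0_eq; last first.
    move=> y _; case: ifPn => // /and3P[_ xy yy0].
    by move: (lt_le_trans y0x (le_trans xy yy0)); rewrite ltxx.
  by rewrite /bridge_weight !indicE !mem_setE !in_itv/= leNgt y0x /= mulr0n mulr0 subrr.
pose a := Num.max x 0.
have ay0 : a <= y0 by rewrite ge_max xy0 ltW.
have mfE : measurable_fun setT (fun y : R => (if [&& 0 < y, x <= y & y <= y0] then g x y else 0)%:E).
  apply/measurable_EFinP; apply: measurable_fun_ifT => //.
    by apply: measurable_and; [exact: measurable_fun_ltr|apply: measurable_and; exact: measurable_fun_ler].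
  by apply: continuous_measurable_fun; exact: continuous_g.
(* The region of integration excludes [y = 0], so it can differ from the closed interval from [a] to
   [y0], but only at the point [a], which is removed. *)
rewrite -(@integral_setD1 _ _ a setT); last 2 first.
- exact: measurableD.
- exact: measurable_funTS.
transitivity (\int[leb]_(y in setT `\ a) (((fun y => (g x y)%:E) \_ `[a, y0]) y))%E.
  apply: eq_integral => y; rewrite inE => -[_ /= ya].
  rewrite patchE mem_setE in_itv/= ge_max -andbA.
  have [xy|] := boolP (x <= y); last by rewrite andbF.
  rewrite andTb /= (le_eqVlt 0 y); case: (eqVneq 0 y) => [y0'|y0'] /=; last by case: (0 < y) => //=; case: (y <= y0).
  exfalso; apply: ya; rewrite /a -y0' (max_idPr _)//.
  by rewrite y0'.
rewrite integral_setD1; last 2 first.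
- exact: measurableD.
- apply: measurable_funTS; apply/(measurable_restrictT _ _).1; first exact: measurable_itv.
  by apply/measurable_EFinP/measurable_funTS; apply: continuous_measurable_fun; exact: continuous_g.
rewrite -integral_mkcond (integral_deriv ay0 (@continuous_g x) (is_derive_E x)).
congr EFin.
(* The exponent 2 a (x - a) / t vanishes, since [a] is either 0 or [x]. *)
have -> : E x a = - 1.
  rewrite /E /a; have [x0|x0] := leP x 0; first by rewrite mulr0 !mul0r expR0.
  by rewrite subrr mulr0 mul0r expR0.
rewrite /bridge_weight !indicE !mem_setE !in_itv/= xy0 mulr1 sqr_sqrtr ?ltW//.
by rewrite /E opprK addrC.
Qed.

Let ge0_integral_X (f : R -> R) : measurable_fun setT f -> (forall x, 0 <= f x) ->
  (\int[distribution P X]_x (f x)%:E = \int[normal_prob (mu * st ^+ 2) st]_x (f x)%:E)%E.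
Proof.
move=> mf f0.
rewrite -ge0_integral_normal_law; last 2 first.
- exact/measurable_EFinP.
- by move=> x; rewrite lee_fin.
apply: (eq_measure_integral (normal_law (mu * st ^+ 2) st)) => A mA _.
change (P (drifted W mu t @^-1` A) = normal_prob (mu * st ^+ 2) st A).
by rewrite (drifted_law ht hW hM mA) sqr_sqrtr// ltW.
Qed.

Let outer_integral (x0 y0 : R) : 0 < y0 ->
  (\int[distribution P X]_x (\1_(`]-oo, x0]%classic : set R) x *
    (\1_(`]-oo, y0]%classic : set R) x - bridge_weight st y0 y0 x))%:E =
   P (drifted W mu t @^-1` `]-oo, x0]%classic `&` M @^-1` `]-oo, y0]%classic))%E.
Proof.
move=> y00; set b := Num.min x0 y0.
have by0 : b <= y0 by rewrite ge_min lexx orbT.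
pose I (x : R) : R := \1_(`]-oo, b]%classic : set R) x.
pose br (x : R) := bridge_weight st y0 b x.
have mI : measurable_fun setT I by exact: measurable_indic.
have mbr : measurable_fun setT br by exact: measurable_bridge_weight.
have brI x : br x <= I x by exact: bridge_weight_le by0 (ltW y00).
have Ib0 x : 0 <= I x - br x by rewrite subr_ge0.
have E1 x : \1_(`]-oo, x0]%classic : set R) x *
    (\1_(`]-oo, y0]%classic : set R) x - bridge_weight st y0 y0 x) = I x - br x.
  rewrite /I /br /bridge_weight !indicE !mem_setE !in_itv/= le_min.
  by case: (x <= x0) => /=; [rewrite mul1r|rewrite mul0r mulr0 subrr].
under eq_integral do rewrite E1.
rewrite (joint_max_le ht hW hM) -/b (joint_below ht hW hM (ltW y00) by0).
have mIb : measurable_fun setT (fun x => I x - br x) by exact: measurable_funB.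
rewrite ge0_integral_X//.
have J1 : (\int[normal_prob (mu * st ^+ 2) st]_x (I x)%:E = (Phi ((b - mu * t) / st))%:E)%E.
  rewrite integral_indic// setIT.
  transitivity (Phi ((b - mu * st ^+ 2) / st))%:E; first exact: normal_prob_Nyc.
  by rewrite sqr_sqrtr// ltW.
have J2 : (\int[normal_prob (mu * st ^+ 2) st]_x (br x)%:E =
    (expR (2 * mu * y0) * Phi ((b - 2 * y0 - mu * t) / st))%:E)%E.
  by rewrite integral_bridge_weight// sqr_sqrtr// ltW.
(* Stated as a sum to stay with nonnegative integrands; the finite term is cancelled afterwards. *)
have : (\int[normal_prob (mu * st ^+ 2) st]_x (I x - br x)%:E +
    \int[normal_prob (mu * st ^+ 2) st]_x (br x)%:E =
    \int[normal_prob (mu * st ^+ 2) st]_x (I x)%:E)%E.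
  rewrite -ge0_integralD//.
  - by apply: eq_integral => x _; rewrite -EFinD subrK.
  - by move=> x _; rewrite lee_fin.
  - exact/measurable_EFinP.
  - by move=> x _; rewrite lee_fin bridge_weight_ge0.
  - exact/measurable_EFinP.
rewrite J1 J2 => J; rewrite EFinB -J.
by rewrite addeK.
Qed.

Let joint_density (A : set (R * R)) : measurable A ->
  P [set w | A (drifted W mu t w, M w)] =
  (\int[distribution P X \x distribution P M]_(z in A) (h (FG z))%:E)%E.
Proof.
move=> mA.
have mXM : measurable_fun setT (fun w => (drifted W mu t w, M w)).
  by apply: measurable_fun_pair; exact: measurable_funP.
transitivity (image_measure P mXM A); first by [].
transitivity (density_measure (distribution P X \x distribution P M)%E mhFG hFG_ge0 A); last by [].
apply: finite_measure_joint_cdf_unique mA.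
  by change (P setT < +oo)%E; rewrite probability_setT ltry.
move=> x0 y0.
transitivity (P (drifted W mu t @^-1` `]-oo, x0]%classic `&` M @^-1` `]-oo, y0]%classic)); first by [].
transitivity (\int[distribution P X \x distribution P M]_(z in `]-oo, x0]%classic `*` `]-oo, y0]%classic) (h (FG z))%:E)%E; last by [].
pose f (z : R * R) : R := \1_(`]-oo, x0]%classic : set R) z.1 * (h (FG z) * \1_(`]-oo, y0]%classic : set R) z.2).
have mi (r : R) : measurable_fun setT (\1_(`]-oo, r]%classic : set R) : R -> R).
  exact: measurable_indic.
have mf : measurable_fun setT f.
  apply: measurable_funM.
    exact: (measurableT_comp (mi x0) measurable_fst).
  apply: measurable_funM => //.
  exact: (measurableT_comp (mi y0) measurable_snd).
have f0 z : 0 <= f z by rewrite mulr_ge0// mulr_ge0.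
transitivity (\int[distribution P X \x distribution P M]_z (f z)%:E)%E; last first.
  rewrite [RHS]integral_mkcond; apply: eq_integral => z _.
  rewrite patchE /f !indicE !mem_setE !in_itv/=.
  have [/set_mem[/=]|] := boolP (z \in _); first by rewrite !in_itv/= => -> ->; rewrite mulr1 mul1r.
  rewrite notin_setE /= !in_itv/= => /not_andP[/negP/negbTE ->|/negP/negbTE ->]; first by rewrite mul0r.
  by rewrite !mulr0.
rewrite (fubini_tonelli1 (m1 := distribution P X) (m2 := distribution P M)); last 2 first.
- exact/measurable_EFinP.
- by move=> z; rewrite lee_fin.
(* For [y0 <= 0] both sides vanish: [G] is 0 there, which puts the argument of [h] outside the open
   square and makes the event on [M] null. *)
have [y00|y00] := leP y0 0.
  rewrite integral0_eq; last first.
    move=> x _; rewrite /fubini_F integral0_eq// => y _; rewrite /f /=.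
    rewrite !indicE !mem_setE !in_itv/=; have [yy0|] := boolP (y <= y0); last by rewrite mulr0n !mulr0.
    rewrite mulr1n mulr1 /h patchE memNset ?mulr0// => -[_] /=.
    by rewrite in_itv/= Gneg ?ltxx// (le_trans yy0).
  apply/eqP; rewrite -measure_le0 -[leRHS](_ : P (M @^-1` `]-oo, y0]%classic) = 0%E).
    apply: le_measure; rewrite ?inE.
    - apply: measurableI; rewrite -[X in measurable X]setTI; first exact: measurable_drifted.
      exact: measurable_funP.
    - by rewrite -[X in measurable X]setTI; exact: measurable_funP.
    - by move=> w [].
  by rewrite -dist_funE Gneg.
rewrite -outer_integral//; apply: eq_integral => x _.
rewrite /fubini_F /f /= EFinM -inner_integral// -ge0_integralZl//.
- apply/measurable_EFinP; apply: measurable_funM; last exact: measurable_indic.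
  apply: (measurableT_comp (f := h) (g := fun y => (F x, G y)) mh).
  by apply: measurable_fun_pair => //; exact: measurable_dist_fun.
- by move=> y _; rewrite lee_fin mulr_ge0.
Qed.

Lemma copula_formula_density (C : R -> R -> R) : copula_of X M C -> copula_density C c.
Proof.
move=> CXM; have [_ _ [Q QC] _] := CXM; exists Q => //; split.
- exact: mD.
- exact: measurable_copula_density.
- by move=> z [/=]; rewrite !in_itv/=; exact: copula_density_ge0.
move=> A mA.
have mA' : measurable (A : set (R * R)) by exact: mA.
rewrite (copula_of_unique cF cG CXM QC mA') copula_measureE.
(* With density and indicator of [A] merged into one function on the square, the change of variables
   in both coordinates is a single application. *)
pose p (z : R * R) : \bar R := (h z * \1_A z)%:E.
have mp : measurable_fun setT p.
  by apply/measurable_EFinP/measurable_funM => //; exact: measurable_indic.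
have p0 z : (0 <= p z)%E by rewrite lee_fin mulr_ge0.
have mFGA : measurable (FG @^-1` A) by rewrite -[X in measurable X]setTI; exact: mFG.
transitivity (P [set w | (FG @^-1` A) (drifted W mu t w, M w)]); first by [].
rewrite (joint_density mFGA).
transitivity (\int[distribution P X \x distribution P M]_z p (F z.1, G z.2))%E.
  rewrite [LHS]integral_mkcond; apply: eq_integral => z _.
  have zA : (z \in FG @^-1` A) = (FG z \in A) by apply/idP/idP; rewrite !inE.
  rewrite patchE zA /p indicE -/(FG z).
  by case: ifPn => _; rewrite ?mulr1 ?mulr0.
rewrite (ge0_integral_dist_fun2 cF cG mp p0).
rewrite [RHS]integral_mkcond [LHS]integral_mkcond; apply: eq_integral => z _.
rewrite !patchE /p /h patchE in_setI -/D indicE.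
case: (boolP (z \in D)) => zD //=.
by case: ifPn => _; rewrite ?mulr1 ?mulr0.
Qed.

End copula_formula.

Theorem mainTheorem2 (R : realType) (d : measure_display)
    (T : measurableType d) (P : probability T R)
    (W : R -> {RV P >-> R}) (mu t : R) (M : {RV P >-> R})
    (ht : 0 < t)
    (hW : standard_brownian_motion W)
    (hM : running_max (drifted W mu) t M) :
  let zeta := quantile (dist_fun M) in
  [/\ exists C : R -> R -> R, copula_of (drifted W mu t) M C,
      forall C : R -> R -> R, copula_of (drifted W mu t) M C ->
        (forall u v : R, 0 < u < 1 -> 0 < v < 1 ->
           C u v = BM_max_copula mu t zeta u v) /\
        copula_density C (BM_max_copula_density mu t zeta)
    & density_on lebesgue_measure (distribution P M) `]0, +oo[
        (max_density mu t)].
Proof.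
move=> zeta; split.
- apply: copula_of_exists; first exact: continuous_dist_fun_drifted ht hW hM.
  exact: continuous_dist_fun_max ht hW hM.
- move=> C CXM; split; last exact: (copula_formula_density ht hW hM CXM).
  by move=> u v; exact: (copula_formula ht hW hM CXM).
- exact: max_density_on ht hW hM.
Qed.
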